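(* The following statements are equivalent for a cardinal $\kappa$: (i) $\kappa$ is a Kunen cardinal. (ii) All equivalent norms on $\ell^1(\kappa)$ are $\mathrm{Ba}(\ell^1(\kappa)_w)$-measurable. (iii) All equivalent norms on $C(2^\kappa)$ are $\mathrm{Ba}(C_w(2^\kappa))$-measurable.
   Context: A cardinal $\kappa$ is a Kunen cardinal if $\mathcal{P}(\kappa\times\kappa)=\mathcal{P}(\kappa)\otimes\mathcal{P}(\kappa)$, i.e. the power set of $\kappa\times\kappa$ coincides with the $\sigma$-algebra on $\kappa\times\kappa$ generated by all products $A\times B$ with $A,B\subset\kappa$. $2^\kappa=\{0,1\}^\kappa$ is the Cantor cube with the product topology, and $C(2^\kappa)$ is the Banach space of continuous real-valued functions on it with the supremum norm. For a (real) Banach space $X$, $X_w$ is $X$ with its weak topology; $C_w(2^\kappa)$ is $C(2^\kappa)$ with its weak topology. $\mathrm{Ba}(X_w)$ is the $\sigma$-algebra on $X$ generated by all weakly continuous real-valued functions on $X$ (it is well known that it equals the $\sigma$-algebra generated by $X^*$). A norm on $X$ is $\mathrm{Ba}(X_w)$-measurable if it is measurable as a real-valued function on $(X,\mathrm{Ba}(X_w))$. *)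

(* Defs.v *)
From HB Require Import structures.
From mathcomp Require Import all_boot all_order all_algebra.
From mathcomp Require Import all_classical all_reals all_analysis.

Set Implicit Arguments.
Unset Strict Implicit.
Unset Printing Implicit Defensive.

Import Order.TTheory GRing.Theory Num.Theory.
Import numFieldNormedType.Exports.

Local Open Scope classical_set_scope.
Local Open Scope ring_scope.

(* A cardinal is represented by a set of that cardinality, i.e. by an arbitrary
   choiceType (classically, every type is one); K may be empty or finite. *)
Definition Kunen_cardinal (K : choiceType) : Prop :=
  <<s [set A `*` B | A in [set: set K] & B in [set: set K]] >>
  = [set: set (K * K)].

Section weak_topology.
Context {R : realType} (X : normedModType R).

Definition dual : Type := {phi : {scalar X} | continuous phi}.

(* The coarsest topology making every element of the dual continuous. *)
Definition weak : Type :=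
  sup_topology (fun phi : dual =>
    Topological.class (initial_topology (sval phi : X -> R))).

HB.instance Definition _ := Topological.copy weak
  (sup_topology (fun phi : dual =>
    Topological.class (initial_topology (sval phi : X -> R)))).

Definition Ba_generators : set (set X) :=
  \bigcup_(f in [set f : weak -> R | continuous f])
    preimage_set_system [set: X] f measurable.

Definition Ba : Type := g_sigma_algebraType Ba_generators.

HB.instance Definition _ := Measurable.copy Ba
  (g_sigma_algebraType Ba_generators).

End weak_topology.

Section equivalent_norm.
Context {R : realType} (X : normedModType R).

Definition is_norm (N : X -> R) : Prop :=
  [/\ forall x y, N (x + y) <= N x + N y,
      forall (a : R) x, N (a *: x) = `|a| * N x
    & forall x, N x = 0 -> x = 0].

Definition equivalent_norm (N : X -> R) : Prop :=
  is_norm N /\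
  exists c C : R, [/\ 0 < c, 0 < C & forall x, c * `|x| <= N x <= C * `|x|].

Definition Ba_measurable (N : X -> R) : Prop :=
  measurable_fun [set: Ba X] (N : Ba X -> R).

End equivalent_norm.

Section l1.
Context (R : realType) (K : choiceType).

Definition abs_summable : {pred K -> R} :=
  mem [set f : K -> R | summable [set: K] (EFin \o f)].

Lemma abs_summable_submod : submod_closed abs_summable.
Proof.
split=> [|a f g]; rewrite ?inE/= /summable.
  by rewrite esum1 ?ltry// => i _; rewrite /= normr0.
move=> sf sg; have Zf :
    (\esum_(x in [set: K]) `|(a * f x)%:E| < +oo)%E.
  have [->|a0] := eqVneq a 0.
    by rewrite esum1 ?ltry// => i _; rewrite mul0r/= normr0.
  apply: (@le_lt_trans _ _
    (`|a|%:E * \esum_(x in [set: K]) `|(EFin \o f) x|)%E).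
    apply: ge_ereal_sup => _ [A [finA _] <-].
    rewrite (eq_fsbigr (fun x => `|a|%:E * `|(f x)%:E|)%E); last first.
      by move=> x _; rewrite /= normrM EFinM.
    rewrite fsbig_finite//= -ge0_sume_distrr//.
    rewrite lee_wpmul2l ?lee_fin//; apply: esum_ge; exists A => //.
    by rewrite fsbig_finite.
  by rewrite lte_mul_pinfty ?lee_fin//; exact.
exact: (@summableD _ _ setT (fun x => (a * f x)%:E) (EFin \o g)).
Qed.

HB.instance Definition _ := GRing.isSubmodClosed.Build _ _ abs_summable
  abs_summable_submod.

Record ell1 : Type := Ell1 {
  ell1_fun :> K -> R ;
  _ : ell1_fun \in abs_summable }.

HB.instance Definition _ := [isSub for ell1_fun].
HB.instance Definition _ := [Choice of ell1 by <:].
HB.instance Definition _ := [SubChoice_isSubLmodule of ell1 by <:].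

Definition ell1_norm (f : ell1) : R :=
  fine (\esum_(x in [set: K]) `|(f x)%:E|)%E.

Lemma ell1_normE (f : ell1) :
  ((ell1_norm f)%:E = \esum_(x in [set: K]) `|(f x)%:E|)%E.
Proof.
by rewrite /ell1_norm fineK//; move: (valP f); rewrite inE/= summableE.
Qed.

Lemma ler_ell1_normD f g : ell1_norm (f + g) <= ell1_norm f + ell1_norm g.
Proof.
rewrite -lee_fin EFinD !ell1_normE -esumD//.
by apply: le_esum => x _; rewrite lee_fin; exact: ler_normD.
Qed.

Let ell1_normZ_le (a : R) f : ell1_norm (a *: f) <= `|a| * ell1_norm f.
Proof.
rewrite -lee_fin EFinM !ell1_normE; apply: ge_ereal_sup => _ [A [finA _] <-].
rewrite (eq_fsbigr (fun x => `|a|%:E * `|(f x)%:E|)%E); last first.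
  by move=> x _; rewrite /= normrM EFinM.
rewrite fsbig_finite//= -ge0_sume_distrr//.
rewrite lee_wpmul2l ?lee_fin//; apply: esum_ge; exists A => //.
by rewrite fsbig_finite.
Qed.

Lemma ell1_normZ (a : R) f : ell1_norm (a *: f) = `|a| * ell1_norm f.
Proof.
apply/eqP; rewrite eq_le ell1_normZ_le/=.
have [->|a0] := eqVneq a 0.
  by rewrite normr0 mul0r fine_ge0// esum_ge0.
rewrite -ler_pdivlMl ?normr_gt0//.
rewrite -normfV (le_trans _ (ell1_normZ_le _ _))//.
by rewrite scalerA mulVf// scale1r.
Qed.

Lemma ell1_norm0_eq0 f : ell1_norm f = 0 -> f = 0.
Proof.
move=> f0; apply/val_inj/funext => x /=; apply/eqP; rewrite -normr_le0.
rewrite -lee_fin -[leRHS]/((0 : R)%:E) -f0 ell1_normE.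
apply: esum_ge; exists [set x]; first by split.
by rewrite fsbig_set1.
Qed.

HB.instance Definition _ := Lmodule_isNormed.Build R ell1
  ler_ell1_normD ell1_normZ ell1_norm0_eq0.

End l1.

(* {ptws K -> bool} is the product topology, bool being discrete. *)
Definition cantor_cube (K : choiceType) : topologicalType := {ptws K -> bool}.

Lemma cantor_cube_compact (K : choiceType) : compact [set: cantor_cube K].
Proof.
have := @tychonoff K (fun=> bool) (fun=> setT) (fun=> bool_compact).
by congr (compact _); apply/seteqP; split.
Qed.

Section C_cube.
Context (R : realType) (K : choiceType).

Definition C_cube : Type := continuousType (cantor_cube K) R.

HB.instance Definition _ := Choice.on C_cube.

Implicit Types f g : C_cube.

Let zero : C_cube := cst 0.

Let opp_cts f : continuous (\- (f : cantor_cube K -> R)).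
Proof. by move=> x; apply: cvgN; exact: cts_fun. Qed.

Let add_cts f g : continuous ((f : cantor_cube K -> R) \+ g).
Proof. by move=> x; apply: cvgD; exact: cts_fun. Qed.

Let scale_cts (a : R) f : continuous (a \*: (f : cantor_cube K -> R)).
Proof. by move=> x; apply: cvgMl_tmp; exact: cts_fun. Qed.

Let opp f : C_cube := mkcts (@opp_cts f).
Let add f g : C_cube := mkcts (@add_cts f g).
Let scale (a : R) f : C_cube := mkcts (@scale_cts a f).

Let addA : associative add.
Proof. by move=> f g h; apply/continuousEP => x; exact: addrA. Qed.
Let addC : commutative add.
Proof. by move=> f g; apply/continuousEP => x; exact: addrC. Qed.
Let add0 : left_id zero add.
Proof. by move=> f; apply/continuousEP => x; exact: add0r. Qed.
Let addN : left_inverse zero opp add.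
Proof. by move=> f; apply/continuousEP => x; exact: addNr. Qed.

HB.instance Definition _ := GRing.isZmodule.Build C_cube addA addC add0 addN.

Let scaleA a b f : scale a (scale b f) = scale (a * b) f.
Proof. by apply/continuousEP => x; exact: mulrA. Qed.
Let scale1 : left_id 1 scale.
Proof. by move=> f; apply/continuousEP => x; exact: mul1r. Qed.
Let scaleDr : right_distributive scale +%R.
Proof. by move=> a f g; apply/continuousEP => x; exact: mulrDr. Qed.
Let scaleDl f : {morph scale^~ f : a b / a + b}.
Proof. by move=> a b; apply/continuousEP => x; exact: mulrDl. Qed.

HB.instance Definition _ := GRing.Zmodule_isLmodule.Build R C_cube
  scaleA scale1 scaleDr scaleDl.

Definition sup_norm f : R := sup [set `|f x| | x in [set: cantor_cube K]].

Lemma sup_norm_has_sup f :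
  has_sup [set `|f x| | x in [set: cantor_cube K]].
Proof.
split; first by exists `|f (fun=> false)|, (fun=> false).
have /compact_bounded[M [_ /(_ (M + 1))]] :
    compact ((f : cantor_cube K -> R) @` setT).
  apply: continuous_compact; last exact: cantor_cube_compact.
  by apply: continuous_subspaceT; exact: cts_fun.
rewrite ltrDl => /(_ ltr01) fM.
by exists (M + 1) => _ [x _ <-]; apply: fM; exists x.
Qed.

Lemma ler_sup_norm f x : `|f x| <= sup_norm f.
Proof. by apply: sup_upper_bound; [exact: sup_norm_has_sup|exists x]. Qed.

Lemma sup_norm_le f M : (forall x, `|f x| <= M) -> sup_norm f <= M.
Proof.
move=> fM; apply: ge_sup; first by case: (sup_norm_has_sup f).
by move=> _ [x _ <-].
Qed.

Lemma ler_sup_normD f g : sup_norm (f + g) <= sup_norm f + sup_norm g.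
Proof.
apply: sup_norm_le => x; rewrite (le_trans (ler_normD (f x) (g x)))//.
by rewrite lerD// ler_sup_norm.
Qed.

Let sup_normZ_le (a : R) f : sup_norm (a *: f) <= `|a| * sup_norm f.
Proof.
apply: sup_norm_le => x; rewrite [leLHS](normrM a (f x)).
by rewrite ler_wpM2l// ler_sup_norm.
Qed.

Lemma sup_normZ (a : R) f : sup_norm (a *: f) = `|a| * sup_norm f.
Proof.
apply/eqP; rewrite eq_le sup_normZ_le/=.
have [->|a0] := eqVneq a 0.
  by rewrite normr0 mul0r (le_trans (normr_ge0 _) (ler_sup_norm _ (fun=> false))).
rewrite -ler_pdivlMl ?normr_gt0//.
rewrite -normfV (le_trans _ (sup_normZ_le _ _))//.
by rewrite scalerA mulVf// scale1r.
Qed.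

Lemma sup_norm0_eq0 f : sup_norm f = 0 -> f = 0.
Proof.
move=> f0; apply/continuousEP => x; apply/eqP.
by rewrite -normr_le0 -f0 ler_sup_norm.
Qed.

HB.instance Definition _ := Lmodule_isNormed.Build R C_cube
  ler_sup_normD sup_normZ sup_norm0_eq0.

End C_cube.

(* Main.v *)
From HB Require Import structures.
Require Import Defs.
From mathcomp Require Import all_boot all_order all_algebra.
From mathcomp Require Import all_classical all_reals all_analysis.
From mathcomp Require Import measurable_realfun ring lra.

(* Both spaces embed, up to a constant, into functions on [2^K] which are
   uniformly approximated by functions of finitely many coordinates.  A Kunen
   cardinal carries a sequence of subsets separating its points, so such a
   function [f] is controlled by countably many points of [2^K].  The coordinates
   on which [f] depends by more than a given [e] form a finite set, and for every
   [A] the set of those [f] for which it meets [A] is measurable; isolating its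
   points with the separating sequence yields countably many measurable
   selectors of coordinates.  Since Kunen's property passes to finite sequences
   ([K * K] embeds in an infinite [K]), an arbitrary set of tuples of selected
   coordinates pulls back to a measurable set, and every open set is a countable
   union of sets obtained in this way.

   Conversely, given bounded biorthogonal families [e_a], [phi_a] and an
   off-diagonal [D], the norm
   [sup ({|x|} u {|phi_c x + 2 phi_d x| : (c, d) in D})] takes the value [5] at
   [e_a + 2 e_b] exactly when [(a, b)] is in [D].  Baire sets for the weak
   topology lie in the sigma-algebra generated by the dual (Edgar), so they pull
   back along [(a, b) |-> e_a + 2 e_b] to the product sigma-algebra.  Edgar's
   theorem is obtained by a closing-off argument: a countable set of functionals
   is chosen such that every box over it that meets a given weakly open set
   contains a smaller box over it inside that set. *)

Set Implicit Arguments.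
Unset Strict Implicit.
Unset Printing Implicit Defensive.

Import Order.TTheory GRing.Theory Num.Theory.
Import numFieldNormedType.Exports.

Local Open Scope classical_set_scope.
Local Open Scope ring_scope.

(** * Kunen's property for finite sequences *)

(** Zorn's lemma on graphs of partial injections: a maximal one is total on [A] or covers [B], since
    otherwise a pair could be added. *)
Lemma set_comparable (T : Type) (A B : set T) :
  (exists g : T -> T, (forall x, A x -> B (g x)) /\
     (forall x y, A x -> A y -> g x = g y -> x = y)) \/
  (exists g : T -> T, (forall x, B x -> A (g x)) /\
     (forall x y, B x -> B y -> g x = g y -> x = y)).
Proof.
pose P (M : set (T * T)) := (forall p, M p -> A p.1 /\ B p.2) /\
  (forall p q, M p -> M q -> p.1 = q.1 <-> p.2 = q.2).
have [F FP totF|M [[MAB Minj] maxM]] := @Zorn_bigcup _ P.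
  split=> [p [X FX Xp]|p q [X FX Xp] [Y FY Yq]].
    by have [+ _] := FP _ FX; apply.
  have [XY|YX] := totF _ _ FX FY.
    by have [_ inj] := FP _ FY; exact: inj (XY _ Xp) Yq.
  by have [_ inj] := FP _ FX; exact: inj Xp (YX _ Yq).
have [domM|/existsNP[a /not_implyP[Aa aM]]] :=
    pselect (forall a, A a -> exists b, M (a, b)).
  left; have /choice[g gM] : forall a, exists b, A a -> M (a, b).
    move=> a; have [Aa|nAa] := pselect (A a); last by exists a.
    by have [b Mab] := domM _ Aa; exists b.
  exists g; split=> [x Ax|x y Ax Ay gxy]; first by have [] := MAB _ (gM _ Ax).
  by have [_ /(_ gxy)] := Minj _ _ (gM _ Ax) (gM _ Ay).
have [ranM|/existsNP[b /not_implyP[Bb bM]]] :=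
    pselect (forall b, B b -> exists a, M (a, b)).
  right; have /choice[g gM] : forall b, exists a, B b -> M (a, b).
    move=> b; have [Bb|nBb] := pselect (B b); last by exists b.
    by have [c Mcb] := ranM _ Bb; exists c.
  exists g; split=> [x Bx|x y Bx By gxy]; first by have [] := MAB _ (gM _ Bx).
  by have [/(_ gxy)] := Minj _ _ (gM _ Bx) (gM _ By).
exfalso; apply: (maxM (M `|` [set (a, b)])).
  split=> [p Mp|]; first by left.
  by move/(_ (a, b) (or_intror erefl)) => Mab; apply: aM; exists b.
split=> [p [/MAB//|->//]|p q [Mp|->] [Mq|->]] //=.
- exact: Minj.
- split=> e; exfalso.
    by apply: aM; exists p.2; rewrite -e -surjective_pairing.
  by apply: bM; exists p.1; rewrite -e -surjective_pairing.
- split=> e; exfalso.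
    by apply: aM; exists q.2; rewrite e -surjective_pairing.
  by apply: bM; exists q.1; rewrite e -surjective_pairing.
Qed.

Section square.
Variable T : Type.

(** Only the graph of a pairing is stored; the set on which it lives is read off from its diagonal
    entries. *)
Definition gdom (G : set ((T * T) * T)) : set T :=
  [set a | exists z, G ((a, a), z)].

Definition partial_pairing (G : set ((T * T) * T)) : Prop :=
  [/\ forall p q, G p -> G q -> p.1 = q.1 <-> p.2 = q.2,
      forall a b, gdom G a -> gdom G b -> exists z, G ((a, b), z) &
      forall a b z, G ((a, b), z) -> [/\ gdom G a, gdom G b & gdom G z]].

Lemma gdomS G G' : G `<=` G' -> gdom G `<=` gdom G'.
Proof. by move=> GG' a [z Ga]; exists z; exact: GG'. Qed.

Lemma partial_pairing_bigcup (F : set (set ((T * T) * T))) :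
  (forall X, F X -> X !=set0 -> partial_pairing X) -> total_on F subset ->
  partial_pairing (\bigcup_(X in F) X).
Proof.
move=> FP totF; split.
- move=> p q [X FX Xp] [Y FY Yq]; have [XY|YX] := totF _ _ FX FY.
    by have [|inj _ _] := FP _ FY; [exists q|exact: inj (XY _ Xp) Yq].
  by have [|inj _ _] := FP _ FX; [exists p|exact: inj Xp (YX _ Yq)].
- move=> a b [z [X FX Xa]] [t [Y FY Yb]].
  have [XY|YX] := totF _ _ FX FY.
    have [|_ + _] := FP _ FY; first by exists (b, b, t).
    move=> /(_ a b)[||w Yw]; [by exists z; exact: XY|by exists t|].
    by exists w, Y.
  have [|_ + _] := FP _ FX; first by exists (a, a, z).
  move=> /(_ a b)[||w Xw]; [by exists z|by exists t; exact: YX|].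
  by exists w, X.
- move=> a b z [X FX Xabz].
  have [|_ _ /(_ _ _ _ Xabz)[]] := FP _ FX; first by exists (a, b, z).
  have XF : gdom X `<=` gdom (\bigcup_(X in F) X).
    by apply: gdomS => ? ?; exists X.
  by move=> *; split; exact: XF.
Qed.

(* Zorn's lemma gives a maximal [B] with a pairing [B * B -> B] extending one on
   a countable subset.  If the complement of [B] does not inject into [B], the
   pairing extends to [B] together with a disjoint copy of [B]. *)
Lemma infinite_pairing (f0 : nat -> T) : injective f0 ->
  exists p : T -> T -> T, forall a b c d, p a b = p c d -> a = c /\ b = d.
Proof.
move=> f0_inj.
pose G0 : set ((T * T) * T) :=
  [set ((f0 ij.1, f0 ij.2), f0 (pickle ij)) | ij in [set: nat * nat]].
have G0P : partial_pairing G0.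
  have G0d i : gdom G0 (f0 i) by exists (f0 (pickle (i, i))), (i, i).
  have G0d' a : gdom G0 a -> exists i, a = f0 i.
    by move=> [z [[i j] _ /= [<- _ _]]]; exists i.
  split.
  - move=> _ _ [[i j] _ <-] [[k l] _ <-] /=; split=> [[]|].
      by move=> /f0_inj -> /f0_inj ->.
    by move=> /f0_inj/(pcan_inj pickleK) [-> ->].
  - move=> a b /G0d'[i ->] /G0d'[j ->].
    by exists (f0 (pickle (i, j))), (i, j).
  - by move=> a b z [[i j] _ /= [<- <- <-]]; split; exact: G0d.
(* The guard [G !=set0] lets the union of the empty chain satisfy the predicate. *)
have [F FP totF|G [GP maxG]] :=
    @Zorn_bigcup _ (fun G => G !=set0 -> G0 `<=` G /\ partial_pairing G).
  move=> [x [X FX Xx]]; split.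
    have [|G0X _] := FP _ FX; first by exists x.
    by move=> y G0y; exists X => //; exact: G0X.
  apply: partial_pairing_bigcup => // Y FY Y0.
  by have [] := FP _ FY.
have {GP} [G0G [Gfun Gtot Gdom]] : G0 `<=` G /\ partial_pairing G.
  have [/GP//|/set0P/negP/negPn/eqP GE] := pselect (G !=set0).
  exfalso; apply: (maxG G0) => [|_]; last by split.
  rewrite GE; split=> [x []//|].
  by move=> /(_ (f0 0%N, f0 0%N, f0 (pickle (0%N, 0%N))))/=; apply; exists (0%N, 0%N).
pose B := gdom G.
have B0 i : B (f0 i).
  by exists (f0 (pickle (i, i))); apply: G0G; exists (i, i).
have /choice[f fG] : forall ab : T * T, exists z, B ab.1 -> B ab.2 -> G (ab, z).
  move=> [a b]; have [Ba|] := pselect (B a); last by exists a.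
  have [Bb|] := pselect (B b); last by exists a.
  by have [z Gz] := Gtot _ _ Ba Bb; exists z.
have fB a b : B a -> B b -> B (f (a, b)).
  by move=> Ba Bb; have /Gdom[] : G ((a, b), f (a, b)) by exact: fG.
have f_inj a b c d : B a -> B b -> B c -> B d ->
    f (a, b) = f (c, d) -> a = c /\ b = d.
  move=> Ba Bb Bc Bd e.
  have [_ /(_ e)/= [-> ->]//] := Gfun _ _ (fG (a, b) Ba Bb) (fG (c, d) Bc Bd).
have f01 : f0 0%N <> f0 1%N by move=> /f0_inj.
have [[g [gB g_inj]]|[g [gB g_inj]]] := set_comparable (~` B) B.
  (* [T] injects into [B]: the tags [f0 0%N] and [f0 1%N] tell whether the point was in [B]. *)
  pose u x := if pselect (B x) then f (x, f0 0%N) else f (g x, f0 1%N).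
  have uB x : B (u x).
    by rewrite /u; case: pselect => Bx; apply: fB => //; exact: gB.
  have u_inj : injective u.
    rewrite /u => x y; case: pselect => Bx; case: pselect => By e.
    - by have [] := f_inj _ _ _ _ Bx (B0 _) By (B0 _) e.
    - by have [_ /f01] := f_inj _ _ _ _ Bx (B0 _) (gB _ By) (B0 _) e.
    - by have [_ /esym/f01] := f_inj _ _ _ _ (gB _ Bx) (B0 _) By (B0 _) e.
    - by have [/g_inj ->] := f_inj _ _ _ _ (gB _ Bx) (B0 _) (gB _ By) (B0 _) e.
  exists (fun a b => f (u a, u b)) => a b c d /f_inj[]//.
  by move=> /u_inj -> /u_inj ->.
exfalso.
have /choice[h hg] : forall x, exists y, (exists2 z, B z & x = g z) ->
    B y /\ x = g y.
  move=> x; have [[z Bz ->]|] := pselect (exists2 z, B z & x = g z); last by exists x.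
  by exists z.
pose B' := B `|` g @` B.
pose v x := if pselect (B x) then f (x, f0 0%N) else f (h x, f0 1%N).
have hB x : B' x -> ~ B x -> B (h x) /\ x = g (h x).
  by move=> [//|[z Bz <-]] _; apply: hg; exists z.
have vB x : B' x -> B (v x).
  by rewrite /v => B'x; case: pselect => Bx; apply: fB => //; have [] := hB _ B'x Bx.
have v_inj x y : B' x -> B' y -> v x = v y -> x = y.
  rewrite /v => B'x B'y; case: pselect => Bx; case: pselect => By e.
  - by have [] := f_inj _ _ _ _ Bx (B0 _) By (B0 _) e.
  - have [By' _] := hB _ B'y By.
    by have [_ /f01] := f_inj _ _ _ _ Bx (B0 _) By' (B0 _) e.
  - have [Bx' _] := hB _ B'x Bx.
    by have [_ /esym/f01] := f_inj _ _ _ _ Bx' (B0 _) By (B0 _) e.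
  - have [Bx' ->] := hB _ B'x Bx; have [By' ->] := hB _ B'y By.
    by have [->] := f_inj _ _ _ _ Bx' (B0 _) By' (B0 _) e.
(* Pairs not both in [B] get values in the copy of [B] under [g], which is disjoint from [B], so no
   old value is hit again. *)
pose H : set ((T * T) * T) := [set p | [/\ B' p.1.1, B' p.1.2,
  ~ (B p.1.1 /\ B p.1.2) & p.2 = g (f (v p.1.1, v p.1.2))]].
have Hdom a : gdom (G `|` H) a <-> B' a.
  split=> [[z [Ga|[/= B'a _ _ _]//]]|B'a]; first by left; exists z.
  have [Ba|nBa] := pselect (B a).
    by have [z Gz] := Ba; exists z; left.
  by exists (g (f (v a, v a))); right; split=> //= -[].
have GB a b z : G ((a, b), z) -> [/\ B a, B b & B z] by exact: Gdom.
apply: (maxG (G `|` H)).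
  split=> [p|]; first by left.
  set x := g (f0 0%N).
  have nBx : ~ B x by exact: gB.
  have B'x : B' x by right; exists (f0 0%N).
  move=> /(_ ((x, x), g (f (v x, v x)))) GH.
  have /GB[//] : G ((x, x), g (f (v x, v x))).
  by apply: GH; right; split=> //= -[].
move=> _; split=> [x /G0G|]; first by left.
split.
- move=> [[a b] z] [[c d] t] [Gp|Hp] [Gq|Hq].
  + exact: Gfun.
  + case: Hq => /= B'c B'd ncd tE; have [Ba Bb Bz] := GB _ _ _ Gp.
    split=> [[ac bd]|zt]; exfalso; first by apply: ncd; rewrite -ac -bd.
    apply: (gB (f (v c, v d))); last by rewrite -tE -zt.
    by apply: fB; exact: vB.
  + case: Hp => /= B'a B'b nab zE; have [Bc Bd Bt] := GB _ _ _ Gq.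
    split=> [[ac bd]|zt]; exfalso; first by apply: nab; rewrite ac bd.
    apply: (gB (f (v a, v b))); last by rewrite -zE zt.
    by apply: fB; exact: vB.
  + case: Hp Hq => /= B'a B'b nab zE [/= B'c B'd ncd tE].
    split=> [[ac bd]|]; first by rewrite zE tE ac bd.
    have Bv x y : B' x -> B' y -> B (f (v x, v y)).
      by move=> ? ?; apply: fB; exact: vB.
    rewrite zE tE => /(g_inj _ _ (Bv _ _ B'a B'b) (Bv _ _ B'c B'd)).
    move=> /(f_inj _ _ _ _ (vB _ B'a) (vB _ B'b) (vB _ B'c) (vB _ B'd)) [].
    by move=> /(v_inj _ _ B'a B'c) -> /(v_inj _ _ B'b B'd) ->.
- move=> a b /Hdom B'a /Hdom B'b.
  have [[Ba Bb]|nab] := pselect (B a /\ B b).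
    by have [z Gz] := Gtot _ _ Ba Bb; exists z; left.
  by exists (g (f (v a, v b))); right.
- move=> a b z [/GB[Ba Bb Bz]|[/= B'a B'b nab ->]].
    by split; apply/Hdom; left.
  split; apply/Hdom => //; right; exists (f (v a, v b)) => //.
  by apply: fB; exact: vB.
Qed.

End square.

(** For infinite [T] a sequence is folded through the pairing; the fold forgets the length, which is
    therefore paired in front. *)
Lemma seq_embedding (T : choiceType) :
  (exists j : seq T -> nat, injective j) \/
  (exists j : seq T -> T, injective j).
Proof.
have [/finite_set_countable/countable_injP[c c_inj]|/infiniteP/card_leP] :=
    pselect (finite_set [set: T]).
  left; exists (fun s => pickle (map c s)) => s t /(pcan_inj pickleK).
  by apply: inj_map => x y; apply: c_inj; rewrite inE.
move=> [g]; right.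
pose f n : T := set_val (g (exist _ n (in_setT n))).
have f_inj : injective f.
  move=> m n /val_inj/(inj (in_setT _) (in_setT _)).
  by move=> /(congr1 val).
have [p p_inj] := infinite_pairing f_inj.
pose enc := foldr p (f 0%N).
exists (fun s => p (f (size s)) (enc s)) => s t /p_inj[/f_inj].
elim: s t => [|x s IH] [|y t]//= [st] /p_inj[-> /IH ->//].
Qed.

Definition rectangles (T : Type) : set (set (T * T)) :=
  [set A `*` B | A in [set: set T] & B in [set: set T]].
Arguments rectangles T _ : clear implicits.

Lemma sigma_algebra_pullback (T U : Type) (f : T -> U) (S : set (set T)) :
  sigma_algebra setT S -> sigma_algebra setT [set B | S (f @^-1` B)].
Proof.
move=> [S0 SC SU]; split=> [|B SB|F SF].
- by rewrite /= preimage_set0.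
- by have := SC _ SB; rewrite /= !setTD preimage_setC.
- by rewrite /= preimage_bigcup; exact: SU.
Qed.

(** Injectivity makes [D] the preimage of its image under [jj], and rectangles pull back to
    rectangles. *)
Lemma Kunen_inj (T U : choiceType) (j : U -> T) : injective j ->
  Kunen_cardinal T -> Kunen_cardinal U.
Proof.
move=> j_inj KT; apply/seteqP; split=> // D _.
pose jj := fun u : U * U => (j u.1, j u.2).
have -> : D = jj @^-1` (jj @` D).
  apply/seteqP; split=> [u Du|[a b] [[c d] Dcd []]]; first by exists u.
  by move=> /j_inj <- /j_inj <-.
suff sub : <<s rectangles T >> `<=` [set B | <<s rectangles U >> (jj @^-1` B)].
  by apply: sub; rewrite /rectangles KT.
apply: smallest_sub; first exact: sigma_algebra_pullback.
move=> _ [A _ [B _ <-]]; apply: sub_sigma_algebra.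
by exists (j @^-1` A) => //; exists (j @^-1` B) => //; apply/seteqP; split.
Qed.

Lemma Kunen_countable (T : choiceType) (j : T -> nat) : injective j ->
  Kunen_cardinal T.
Proof.
move=> j_inj; apply/seteqP; split=> // D _.
have -> : D = \bigcup_n (D `&` [set u | pickle (j u.1, j u.2) = n]).
  by apply/seteqP; split=> [u Du|u [n _ []]//]; exists (pickle (j u.1, j u.2)).
apply: sigma_algebra_bigcup => n.
have [[[a b] [Dab] /= abn]|] :=
    pselect (D `&` [set u | pickle (j u.1, j u.2) = n] !=set0).
  apply: sub_sigma_algebra; exists [set a] => //; exists [set b] => //.
  apply/seteqP; split=> [[c d] [/= -> ->]//|[c d] [_ /=]].
  by rewrite -abn => /(pcan_inj pickleK)[/j_inj -> /j_inj ->].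
move=> /set0P/negP/negPn/eqP ->.
by have [] := smallest_sigma_algebra setT (rectangles T).
Qed.

Lemma Kunen_seq (T : choiceType) : Kunen_cardinal T -> Kunen_cardinal (seq T).
Proof.
move=> KT; have [[j j_inj]|[j j_inj]] := seq_embedding T.
  exact: Kunen_countable j_inj.
exact: Kunen_inj j_inj KT.
Qed.

(** * Measurability of open sets over a Kunen cardinal *)

(* A set in the product sigma-algebra is already generated by countably many
   rectangles; apply this to the diagonal. *)
Lemma Kunen_separating (K : choiceType) : Kunen_cardinal K ->
  exists H : nat -> set K, forall a b, (forall n, H n a <-> H n b) -> a = b.
Proof.
move=> KK; pose S (D : set (K * K)) := exists H : nat -> set K,
  forall a a' b b', (forall n, H n a <-> H n a') ->
    (forall n, H n b <-> H n b') -> D (a, b) -> D (a', b').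
suff sub : <<s rectangles K >> `<=` S.
  have /sub[H HD] : <<s rectangles K >> [set ab : K * K | ab.1 = ab.2].
    by rewrite /rectangles KK.
  by exists H => a b Hab; apply: (HD a a a b).
apply: smallest_sub.
  split=> [|D [H HD]|F SF].
  - by exists (fun=> set0).
  - exists H => a a' b b' Ha Hb [_ nD]; split=> // /(HD a' a b' b) D'.
    by apply: nD; apply: D' => n; apply: iff_sym.
  - have [H HF] := choice SF.
    exists (fun n => if unpickle n is Some (i, k) then H i k else set0).
    move=> a a' b b' Ha Hb [i _ Fi]; exists i => //; apply: HF Fi => k.
      by have := Ha (pickle (i, k)); rewrite pickleK.
    by have := Hb (pickle (i, k)); rewrite pickleK.
move=> _ [A _ [B _ <-]]; exists (fun n => if n is 0 then A else B).
by move=> a a' b b' Ha Hb [/= Aa Bb]; split=> /=; [apply/(Ha 0%N)|apply/(Hb 1%N)].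
Qed.

Lemma measurable_ex d (X : measurableType d) (I : countType) (F : I -> set X) :
  (forall i, measurable (F i)) -> measurable [set x | exists i, F i x].
Proof.
move=> mF; rewrite (_ : [set _ | _] = \bigcup_i F i); last first.
  by apply/seteqP; split=> x [i]; exists i.
exact: countable_bigcupT_measurable.
Qed.

Lemma measurable_all d (X : measurableType d) (I : countType) (F : I -> set X) :
  (forall i, measurable (F i)) -> measurable [set x | forall i, F i x].
Proof.
move=> mF; rewrite (_ : [set _ | _] = ~` [set x | exists i, (~` F i) x]).
  by apply: measurableC; apply: measurable_ex => i; exact: measurableC.
apply/seteqP; split=> x /=; first by move=> Fx [i]; apply.
by move=> nF i; apply: contrapT => nFi; apply: nF; exists i.
Qed.

Lemma measurable_gt d (X : measurableType d) (R : realType) (f : X -> R) e :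
  measurable_fun setT f -> measurable [set x | e < f x].
Proof.
move=> mf; rewrite -[X in measurable X]setTI -preimage_itvoy.
by apply: mf => //; exact: measurable_itv.
Qed.

Lemma measurable_le d (X : measurableType d) (R : realType) (f : X -> R) e :
  measurable_fun setT f -> measurable [set x | f x <= e].
Proof.
move=> mf; rewrite (_ : [set _ | _] = ~` [set x | e < f x]).
  exact/measurableC/measurable_gt.
by apply/seteqP; split=> x /=; rewrite leNgt => /negP.
Qed.

Section codes.
Context (K : choiceType) (H : nat -> set K).
Hypothesis H_sep : forall a b, (forall n, H n a <-> H n b) -> a = b.

Definition code m a : seq bool := mkseq (fun i => `[< H i a >]) m.

(** Finitely many pairs are to be separated, so the largest separating index decides; its successor
    is taken because [code m] reads only indices below [m]. *)
Lemma code_inj (F : seq K) : exists m, {in F &, injective (code m)}.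
Proof.
have /choice[n nP] : forall p : K * K, exists n, p.1 <> p.2 ->
    `[< H n p.1 >] <> `[< H n p.2 >].
  move=> [a b] /=; have [->|ab] := pselect (a = b); first by exists 0%N.
  have [n nH] : exists n, ~ (H n a <-> H n b).
    by apply/existsNP => Hab; apply: ab; exact: H_sep.
  exists n => _ e; apply: nH.
  by split=> h; apply/asboolP; [rewrite -e|rewrite e]; apply/asboolP.
exists (\max_(p <- [seq (a, b) | a <- F, b <- F]) (n p).+1)%N => a b aF bF e.
apply: contrapT => ab; apply: (nP (a, b) ab) => /=.
set m := bigop.body _ _ _ in e.
have nm : (n (a, b) < m)%N.
  by apply: (@leq_bigmax_seq _ _ predT (fun p => (n p).+1)) => //; exact: allpairs_f.
have := congr1 (fun s => nth false s (n (a, b))) e.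
by rewrite !nth_mkseq.
Qed.

(** As [m] and [w] vary, these form a countable set of points of the cube, dense by [code_inj] and
    [stepP]. *)
Definition step m (w : seq (seq bool)) (a : K) : bool := code m a \in w.

Lemma stepP m (F : seq K) (s : K -> bool) : {in F &, injective (code m)} ->
  exists w, forall a, a \in F -> step m w a = s a.
Proof.
move=> minj; exists [seq code m a | a <- F & s a] => a aF.
rewrite /step; apply/mapP/idP => [[b]|sa].
  by rewrite mem_filter => /andP[sb bF] /(minj _ _ aF bF) ->.
by exists a => //; rewrite mem_filter sa.
Qed.

End codes.

(** * Oscillation, measurable selectors of coordinates, and open sets *)

Section measurability.
Context (R : realType) (K : choiceType) (d : measure_display)
  (X : measurableType d) (T : X -> (K -> bool) -> R).
Hypothesis T_unif : forall x (e : R), 0 < e -> exists F : seq K,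
  forall s t, (forall a, a \in F -> s a = t a) -> `|T x s - T x t| < e.
Hypothesis T_meas : forall s, measurable_fun [set: X] (T^~ s).

Definition osc (B : set K) (e : R) : set X := [set x | exists s t,
  (forall a, ~ B a -> s a = t a) /\ e < `|T x s - T x t|].

Context (H : nat -> set K).
Hypothesis H_sep : forall a b, (forall n, H n a <-> H n b) -> a = b.

(** A strict inequality survives small changes, so step functions may replace [s] and [t], while
    [mix] keeps the agreement off [B]. This leaves a countable union. *)
Lemma measurable_osc B e : measurable (osc B e).
Proof.
pose mix (s t : K -> bool) a := if pselect (B a) then t a else s a.
pose F (i : nat * (seq (seq bool) * seq (seq bool))) : set X := [set x |
  e < `|T x (step H i.1 i.2.1) - T x (mix (step H i.1 i.2.1) (step H i.1 i.2.2))|].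
rewrite (_ : osc B e = [set x | exists i, F i x]).
  apply: measurable_ex => i; apply: measurable_gt; apply: measurableT_comp => //.
  by apply: measurable_funB; exact: T_meas.
apply/seteqP; split=> x /=; last first.
  move=> [[m [w v]]] /= lte; exists (step H m w), (mix (step H m w) (step H m v)).
  by split=> // a nBa; rewrite /mix; case: pselect.
(* Half of the excess over [e]: each of the two replacements costs less than [r]. *)
move=> [s [t [st lte]]]; pose r := (`|T x s - T x t| - e) / 2.
have r0 : 0 < r by rewrite divr_gt0// subr_gt0.
have [F0 FP] := T_unif x r0; have [m minj] := code_inj H_sep F0.
have [w ws] := stepP s minj; have [v vt] := stepP t minj.
exists (m, (w, v)) => /=; rewrite /F/=.
have h1 : `|T x s - T x (step H m w)| < r by apply: FP => a aF; rewrite ws.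
have h2 : `|T x (mix (step H m w) (step H m v)) - T x t| < r.
  apply: FP => a aF; rewrite /mix; case: pselect => Ba; first exact: vt.
  by rewrite ws// st.
set u := T x (step H m w) in h1 *.
set u' := T x (mix _ _) in h2 *.
have := ler_normD (T x s - u) (u - u').
have := ler_normD (T x s - u + (u - u')) (u' - T x t).
rewrite [_ + _ + (u' - _)](_ : _ = T x s - T x t); last by lra.
have : `|T x s - T x t| = r + r + e by rewrite /r -splitr subrK.
lra.
Qed.

Definition dep (e : R) (A : set K) : set X :=
  [set x | exists2 a, A a & osc [set a] e x].

(* The condition on partitions avoids the uncountable union over [A]: once the
   code separates the finitely many coordinates that matter, a cell of the
   partition on which [x] oscillates contains a single relevant one. *)
Lemma measurable_dep e A : 0 <= e -> measurable (dep e A).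
Proof.
move=> e0; rewrite (_ : dep e A = [set x | exists k : nat, forall m : nat,
    exists v : seq bool, osc (A `&` [set a | code H m a = v]) (e + k.+1%:R^-1) x]).
  apply: measurable_ex => k; apply: measurable_all => m.
  by apply: measurable_ex => v; exact: measurable_osc.
apply/seteqP; split=> x /=.
  move=> [a Aa [s [t [st lte]]]]; have [k kP] := ltr_add_invr lte.
  exists k => m; exists (code H m a), s, t; split=> // b nb.
  by apply: st => /= ba; apply: nb; rewrite ba.
move=> [k kP]; pose r : R := k.+1%:R^-1.
have r0 : 0 < r by rewrite invr_gt0.
have r20 : 0 < r / 2 by rewrite divr_gt0.
have [F FP] := T_unif x r20; have [m minj] := code_inj H_sep F.
have [v [s [t [st]]]] := kP m; rewrite -/r => lte.
have [[b [bF Ab bv]]|nb] :=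
    pselect (exists b, [/\ b \in F, A b & code H m b = v]); last first.
  have : `|T x s - T x t| < r / 2.
    by apply: FP => a aF; apply: st => -[Aa av]; apply: nb; exists a.
  by move: lte; lra.
(* [u] alters [s] only at [b], yet agrees with [t] on [F], since [b] is the only point of [F] in the
   cell. *)
exists b => //; pose u a := if a == b then t b else s a.
have ut : `|T x u - T x t| < r / 2.
  apply: FP => a aF; rewrite /u; case: eqP => [->//|ab].
  by apply: st => -[Aa av]; apply: ab; apply: minj => //; rewrite av.
exists s, u; split=> [a /eqP/negPf ab|]; first by rewrite /u ab.
have := ler_normD (T x s - T x u) (T x u - T x t).
by rewrite addrA subrK; move: ut lte; lra.
Qed.

Let eps (n : nat) : R := n.+1%:R^-1.

Definition isolated (i : nat * seq bool * nat) (x : X) (a : K) : Prop :=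
  [/\ code H i.1.1 a = i.1.2, osc [set a] (eps i.2) x &
   forall b, code H i.1.1 b = i.1.2 -> osc [set b] (eps i.2) x -> b = a].

Definition cell (i : nat * seq bool * nat) : set K :=
  [set a | code H i.1.1 a = i.1.2].

(** Uniqueness is tested countably: two points of the cell above the threshold are separated by some
    [H n]. *)
Lemma measurable_isolated i : measurable [set x | exists a, isolated i x a].
Proof.
have eps0 : 0 <= eps i.2 by rewrite invr_ge0.
rewrite (_ : [set _ | _] = dep (eps i.2) (cell i) `&` ~` [set x | exists n : nat,
    (dep (eps i.2) (cell i `&` H n) `&` dep (eps i.2) (cell i `\` H n)) x]).
  apply: measurableI; first exact: measurable_dep.
  apply: measurableC; apply: measurable_ex => n.
  by apply: measurableI; exact: measurable_dep.
apply/seteqP; split=> x /=.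
  move=> [a [aE ax aU]]; split; first by exists a.
  move=> [n [[b [bE Hb] bx] [c [cE Hc] cx]]].
  by apply: Hc; rewrite (aU _ cE cx) -(aU _ bE bx).
move=> [[a aE ax] nH]; exists a; split=> // b bE bx.
apply: H_sep => n; split=> Hn; apply: contrapT => nHn; apply: nH; exists n.
  by split; [exists b|exists a].
by split; [exists a|exists b].
Qed.

Lemma selector_ex i : exists k : X -> seq K, forall x,
  (forall a, isolated i x a -> k x = [:: a]) /\
  ((forall a, ~ isolated i x a) -> k x = [::]).
Proof.
pose P x l := (forall a, isolated i x a -> l = [:: a]) /\
  ((forall a, ~ isolated i x a) -> l = [::]).
suff /choice[k kP] : forall x, exists l, P x l by exists k.
move=> x; have [[a ai]|na] := pselect (exists a, isolated i x a).
  exists [:: a]; split=> [b bi|/(_ a)//]; congr [:: _].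
  by case: bi => bE bx bU; apply: bU; case: ai.
by exists [::]; split=> // a ai; exfalso; apply: na; exists a.
Qed.

(** The empty list stands for the absence of an isolated coordinate, so no default point of [K] has
    to be chosen and values can be concatenated. *)
Definition selector i : X -> seq K := sval (cid (selector_ex i)).

Lemma selectorE i x a : isolated i x a -> selector i x = [:: a].
Proof. by rewrite /selector; case: cid => /= k kP; have [+ _] := kP x; apply. Qed.

Lemma selector_nil i x : (forall a, ~ isolated i x a) -> selector i x = [::].
Proof. by rewrite /selector; case: cid => /= k kP; have [_] := kP x; apply. Qed.

(** An isolated coordinate is the only one of its cell above the threshold, so a condition on it
    becomes an instance of [dep], measurable for arbitrary sets. *)
Lemma measurable_selector i (B : set (seq K)) : measurable (selector i @^-1` B).
Proof.
have eps0 : 0 <= eps i.2 by rewrite invr_ge0.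
pose E := [set x | exists a, isolated i x a].
have mE : measurable E by exact: measurable_isolated.
rewrite (_ : _ @^-1` _ =
    (E `&` dep (eps i.2) (cell i `&` [set a | B [:: a]])) `|`
    (~` E `&` [set x | B [::]])).
  apply: measurableU; first by apply: measurableI => //; exact: measurable_dep.
  apply: measurableI; first exact: measurableC.
  have [Bn|nBn] := pselect (B [::]).
    by rewrite (_ : [set _ | _] = setT)//; apply/seteqP; split.
  by rewrite (_ : [set _ | _] = set0)//; apply/seteqP; split.
apply/seteqP; split=> x /=.
  have [[a ai]|na] := pselect (E x).
    rewrite (selectorE ai) => Ba; left; split; first by exists a.
    by case: ai => aE ax _; exists a.
  rewrite selector_nil => [Bn|a ai]; first by right.
  by apply: na; exists a.
move=> [[[a ai] [b [bE Bb] bx]]|[nE Bn]].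
  by rewrite (selectorE ai); case: ai => _ _ /(_ b bE bx) <-.
by rewrite selector_nil// => a ai; apply: nE; exists a.
Qed.

(** Kunen's property enters here: every set of pairs lies in the product sigma-algebra, whose
    members pull back along [(k, l)] to measurable sets. *)
Lemma measurable_cat (k l : X -> seq K) : Kunen_cardinal (seq K) ->
  (forall B : set (seq K), measurable (k @^-1` B)) ->
  (forall B : set (seq K), measurable (l @^-1` B)) ->
  forall B : set (seq K), measurable ((fun x => k x ++ l x) @^-1` B).
Proof.
move=> KK mk ml B.
pose f x := (k x, l x).
suff sub : <<s rectangles (seq K) >> `<=` [set D | measurable (f @^-1` D)].
  have := sub [set uv | B (uv.1 ++ uv.2)]; apply.
  by rewrite /rectangles KK.
apply: smallest_sub.
  apply: (@sigma_algebra_pullback _ _ f measurable).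
  exact: sigma_algebra_measurable.
move=> _ [C _ [D _ <-]] /=.
rewrite (_ : _ @^-1` _ = k @^-1` C `&` l @^-1` D)//.
exact: measurableI.
Qed.

Definition selectors (l : seq (nat * seq bool * nat)) (x : X) : seq K :=
  flatten [seq selector i x | i <- l].

Lemma measurable_selectors l (B : set (seq K)) : Kunen_cardinal (seq K) ->
  measurable (selectors l @^-1` B).
Proof.
move=> KK; elim: l B => [|i l IH] B; last first.
  exact: (measurable_cat KK (@measurable_selector i) IH).
have [Bn|nBn] := pselect (B [::]).
  by rewrite (_ : _ @^-1` _ = setT)//; apply/seteqP; split.
by rewrite (_ : _ @^-1` _ = set0)//; apply/seteqP; split.
Qed.

Definition relevant x : set K := [set a | exists n, osc [set a] (eps n) x].

(** The coordinates above a fixed threshold lie in a finite set, where a long enough code isolates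
    each of them. *)
Lemma selectors_relevant x (F : seq K) : (forall a, a \in F -> relevant x a) ->
  exists l, selectors l x = F.
Proof.
elim: F => [_|a F IH aF]; first by exists [::].
have [l lF] : exists l, selectors l x = F.
  by apply: IH => b bF; apply: aF; rewrite inE bF orbT.
have [n an] := aF a (mem_head _ _).
have eps0 : 0 < eps n by rewrite invr_gt0.
have [G GP] := T_unif x eps0; have [m minj] := code_inj H_sep G.
have GO b : osc [set b] (eps n) x -> b \in G.
  move=> [s [t [st lte]]]; apply: contrapT => bG.
  have : `|T x s - T x t| < eps n.
    by apply: GP => c cG; apply: st => /= cb; apply: bG; rewrite -cb.
  by rewrite ltNge (ltW lte).
exists ((m, code H m a, n) :: l); rewrite /selectors/= -/(selectors l x) lF.
rewrite (@selectorE _ _ a)//; split=> //= b bE bx.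
by apply: minj => //; exact: GO.
Qed.

Lemma relevant_approx x (e : R) : 0 < e -> exists F : seq K,
  (forall a, a \in F -> relevant x a) /\
  forall s t, (forall a, a \in F -> s a = t a) -> `|T x s - T x t| < e.
Proof.
move=> e0; have [G GP] := T_unif x e0.
exists [seq a <- G | `[< relevant x a >]]; split=> [a|s t st].
  by rewrite mem_filter => /andP[/asboolP].
pose mix (L : seq K) a := if a \in L then t a else s a.
have mixE L : {subset L <= G} -> T x (mix L) = T x s.
  elim: L => [//|a L IH aLG].
  rewrite -IH; last by move=> b bL; apply: aLG; rewrite inE bL orbT.
  have [ra|nra] := pselect (relevant x a).
    congr (T x); apply/funext => b; rewrite /mix inE; case: eqVneq => //= ->.
    case: ifP => // _; rewrite st// mem_filter aLG ?mem_head// andbT.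
    exact/asboolP.
  apply/eqP; rewrite -subr_eq0 -normr_le0 leNgt; apply/negP => T0.
  apply: nra; have [n] := ltr_add_invr T0; rewrite add0r => nT.
  exists n, (mix (a :: L)), (mix L); split=> // b /= /eqP/negPf ba.
  by rewrite /mix inE ba.
rewrite -(mixE G)//; apply: GP => a aG.
by rewrite /mix aG.
Qed.

(** A countable supply of functions on bit strings: the list is indexed by [pickle w], with value 0
    past its end. *)
Definition table (q : seq rat) (w : seq bool) : R := ratr (nth 0 q (pickle w)).

Lemma table_approx n (g : seq bool -> R) (e : R) : 0 < e ->
  exists q, forall w, size w = n -> `|g w - table q w| < e.
Proof.
move=> e0; have /choice[h hP] : forall w, exists r : rat, `|g w - ratr r| < e.
  move=> w; have [|r] := @rat_in_itvoo R (g w - e) (g w + e); first by lra.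
  by rewrite in_itv/= => /andP[r1 r2]; exists r; rewrite ltr_distlC; lra.
pose N := (\max_(w : n.-tuple bool) (pickle (val w)).+1)%N.
exists (mkseq (fun j => if unpickle j is Some w then h w else 0) N) => w wn.
rewrite /table nth_mkseq ?pickleK//.
exact: (@leq_bigmax _ (fun w : n.-tuple bool => (pickle (val w)).+1)
  (Tuple (introT eqP wn))).
Qed.

(** An index [(q, n, l)] describes [T x] up to [eps n] by a rational table of the selected
    coordinates. The first condition in [W] says that everything fitting the description lies in
    [U]; it is an arbitrary condition on the selected tuple. The second says that [x] itself fits,
    tested on step functions. *)
Lemma measurable_uniform_open (U : set X) : Kunen_cardinal (seq K) ->
  (forall x, U x -> exists2 r : R, 0 < r &
     forall y, (forall s, `|T y s - T x s| <= r) -> U y) ->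
  measurable U.
Proof.
move=> KK Uop.
pose A q r : set (seq K) :=
  [set a | forall y, (forall s, `|T y s - table q (map s a)| <= r) -> U y].
pose W (i : seq rat * nat * seq (nat * seq bool * nat)) : set X :=
  [set x | A i.1.1 (eps i.1.2) (selectors i.2 x)] `&`
  [set x | forall mw : nat * seq (seq bool), `|T x (step H mw.1 mw.2) -
     table i.1.1 (map (step H mw.1 mw.2) (selectors i.2 x))| <= eps i.1.2].
rewrite (_ : U = [set x | exists i, W i x]).
  apply: measurable_ex => -[[q n] l]; apply: measurableI.
    exact: measurable_selectors KK.
  apply: measurable_all => -[m w] /=; apply: measurable_le.
  apply: measurableT_comp => //; apply: measurable_funB; first exact: T_meas.
  move=> _ B mB; rewrite setTI.
  exact: (measurable_selectors l
    [set a | B (table q (map (step H m w) a))] KK).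
apply/seteqP; split=> x /=; last first.
  (* [A] is applied to [x] itself: the fit on step functions extends to every [s], up to any [e], by
     matching [s] on the tuple and on [F]. *)
  move=> [[[q n] l] [/= Ax xn]]; apply: Ax => s.
  set a := selectors l x in xn *; apply/ler_addgt0Pl => e e0.
  have [F FP] := T_unif x e0; have [m minj] := code_inj H_sep (a ++ F).
  have [w ws] := stepP s minj.
  have := xn (m, w); rewrite /=.
  have -> : map (step H m w) a = map s a.
    by apply/eq_in_map => b ba; rewrite ws// mem_cat ba.
  have : `|T x s - T x (step H m w)| < e.
    by apply: FP => b bF; rewrite ws// mem_cat bF orbT.
  have := ler_normD (T x s - T x (step H m w))
    (T x (step H m w) - table q (map s a)).
  by rewrite addrA subrK; lra.
move=> Ux; have [r r0 rU] := Uop x Ux.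
have r20 : 0 < r / 2 by rewrite divr_gt0.
have [n nr] := ltr_add_invr r20; rewrite add0r in nr.
(* One quarter pays for forgetting the coordinates outside [F], one for the rational table; with the
   tolerance [eps n] the total stays below [r]. *)
have n0 : 0 < eps n / 4 by rewrite divr_gt0// invr_gt0.
have [F [Frel FP]] := relevant_approx x n0.
have [l lF] := selectors_relevant Frel.
(* A string of length [size F] is read as the point with these bits on [F] and [false] elsewhere. *)
have [q qP] := table_approx (size F)
  (fun w => T x (fun a => nth false w (index a F))) n0.
have qxn s : `|T x s - table q (map s F)| < eps n / 2.
  have := qP (map s F) (size_map _ _); set u := T x _ => qu.
  have : `|T x s - u| < eps n / 4.
    by apply: FP => a aF; rewrite (nth_map a) ?index_mem// nth_index.
  have := ler_normD (T x s - u) (u - table q (map s F)).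
  by rewrite addrA subrK; move: qu; lra.
exists (q, n, l); split=> /=; rewrite lF.
  move=> y yq; apply: rU => s.
  have := ler_distD (table q (map s F)) (T y s) (T x s).
  rewrite [X in _ <= _ + X -> _]distrC; have := yq s; have := qxn s.
  move: nr; rewrite -/(eps n); lra.
move=> [m w] /=; have := qxn (step H m w); move: n0; lra.
Qed.

End measurability.

(** * Weakly continuous functions and the dual *)

Lemma sigma_algebra_ex (T : Type) (I : countType) (S : set (set T))
    (F : I -> set T) :
  sigma_algebra setT S -> (forall i, S (F i)) -> S [set x | exists i, F i x].
Proof.
move=> [S0 _ SU] SF.
rewrite (_ : [set _ | _] =
    \bigcup_n (if unpickle n is Some i then F i else set0)).
  by apply: SU => n; case: unpickle.
apply/seteqP; split=> [x [i Fi]|x [n _]].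
  by exists (pickle i) => //; rewrite pickleK.
by case: unpickle => // i Fi; exists i.
Qed.

Lemma sigma_algebra_setI (T : Type) (S : set (set T)) A B :
  sigma_algebra setT S -> S A -> S B -> S (A `&` B).
Proof.
move=> sS SA SB; have [_ SC _] := sS.
rewrite (_ : A `&` B = setT `\` [set x | exists b : bool, ~ (if b then A else B) x]).
  apply: (SC); apply: sigma_algebra_ex => // -[].
    by have := SC _ SA; rewrite setTD.
  by have := SC _ SB; rewrite setTD.
apply/seteqP; split=> [x [Ax Bx]|x [_ nx]]; first by split=> // -[[]]; apply.
by split; apply: contrapT => nAB; apply: nx; [exists true|exists false].
Qed.

Section functionals.
Context (R : realType) (V : lmodType R) (D : eqType) (ev : D -> V -> R).
Hypothesis ev_lin : forall p a x y, ev p (a *: x + y) = a * ev p x + ev p y.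

Lemma evD p x y : ev p (x + y) = ev p x + ev p y.
Proof. by have := ev_lin p 1 x y; rewrite scale1r mul1r. Qed.

Lemma ev0 p : ev p 0 = 0.
Proof. by apply: (addrI (ev p 0)); rewrite -evD !addr0. Qed.

Lemma evZ p a x : ev p (a *: x) = a * ev p x.
Proof. by rewrite -[a *: x]addr0 ev_lin ev0 addr0. Qed.

Lemma evB p x y : ev p (x - y) = ev p x - ev p y.
Proof. by rewrite evD -scaleN1r evZ mulN1r. Qed.

(** Quantitative form of the fact that a functional vanishing on the common kernel of finitely many
    others is a combination of them. *)
Lemma kernel_bound (L : seq D) (f : V -> R) :
  (forall a x y, f (a *: x + y) = a * f x + f y) ->
  (forall x, (forall p, p \in L -> ev p x = 0) -> f x = 0) ->
  exists2 M, 0 <= M & forall (e : R) x, 0 <= e ->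
    (forall p, p \in L -> `|ev p x| <= e) -> `|f x| <= M * e.
Proof.
elim: L f => [|p L IH] f f_lin fL.
  by exists 0 => // e x e0 _; rewrite mul0r fL// normr0.
have [[u [uL pu]]|nu] :=
    pselect (exists u, (forall q, q \in L -> ev q u = 0) /\ ev p u = 1); last first.
  have [x xL|M M0 MP] := IH f f_lin.
    apply: fL => q; rewrite inE => /predU1P[->|]; last exact: xL.
    apply/eqP/negPn/negP => px; apply: nu; exists ((ev p x)^-1 *: x).
    by split=> [r rL|]; rewrite evZ; [rewrite (xL _ rL) mulr0|rewrite mulVf].
  exists M => // e x e0 xL; apply: MP => // q qL.
  by apply: xL; rewrite inE qL orbT.
pose g x := f x - f u * ev p x.
have g_lin a x y : g (a *: x + y) = a * g x + g y.
  by rewrite /g f_lin ev_lin; lra.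
have [x xL|M M0 MP] := IH g g_lin.
  have : f (- ev p x *: u + x) = 0.
    apply: fL => q; rewrite inE => /predU1P[->|qL].
      by rewrite ev_lin pu; lra.
    by rewrite ev_lin (uL _ qL) (xL _ qL) mulr0 addr0.
  by rewrite f_lin /g; lra.
exists (M + `|f u|) => [|e x e0 xL]; first by rewrite addr_ge0.
have gx : `|g x| <= M * e.
  by apply: MP => // q qL; apply: xL; rewrite inE qL orbT.
have px : `|f u * ev p x| <= `|f u| * e.
  by rewrite normrM ler_wpM2l// xL// mem_head.
have := ler_normD (g x) (f u * ev p x).
by rewrite /g subrK mulrDl; move: gx px; rewrite /g; lra.
Qed.

(* Relatively to a set [C] of functionals, a weak neighbourhood of [x] splits
   into a constraint on finitely many members of [C] and one which can be met
   whatever the values prescribed on [C]. *)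
Lemma relative_independence (F : seq D) (C : set D) (x : V) (e : R) : 0 < e ->
  exists L : seq D, (forall p, p \in L -> C p) /\ exists2 r : R, 0 < r &
  forall v, (forall p, p \in L -> `|ev p (v - x)| < r) ->
  forall L' : seq D, (forall p, p \in L' -> C p) ->
  exists z, (forall p, p \in L' -> ev p z = ev p v) /\
    forall p, p \in F -> `|ev p (z - x)| < e.
Proof.
move=> e0; elim: F C => [|q F IH] C.
  by exists [::]; split=> //; exists 1 => // v _ L' _; exists v.
(* Either [q] is controlled by finitely many members of [C], which join the constraint, or it is
   independent of [C] and is adjoined to it. *)
have [[K [KC Kq]]|nK] := pselect (exists K : seq D, (forall p, p \in K -> C p) /\
    forall u, (forall p, p \in K -> ev p u = 0) -> ev q u = 0).
  have [M M0 MP] := kernel_bound (ev_lin q) Kq.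
  have [L [LC [r r0 rP]]] := IH C.
  have M1 : 0 < M + 1 by lra.
  exists (K ++ L); split=> [p|].
    by rewrite mem_cat => /orP[/KC|/LC].
  exists (Num.min r (e / (M + 1))); first by rewrite lt_min r0 divr_gt0.
  move=> v vP L' L'C.
  have [p pL|p|z [zK zF]] := rP v _ (K ++ L') _.
  - have := vP p; rewrite mem_cat pL orbT => /(_ isT).
    by rewrite lt_min => /andP[].
  - by rewrite mem_cat => /orP[/KC|/L'C].
  exists z; split=> [p pL'|p]; first by apply: zK; rewrite mem_cat pL' orbT.
  rewrite inE => /predU1P[->|]; last exact: zF.
  have -> : ev q (z - x) = ev q (v - x).
    apply/eqP; rewrite -subr_eq0 -evB; apply/eqP; apply: Kq => s sK.
    by rewrite !evB zK ?mem_cat ?sK//; lra.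
  have := MP (e / (M + 1)) (v - x); rewrite divr_ge0 ?(ltW M1) ?(ltW e0)//.
  move=> /(_ isT); rewrite mulrA => vx.
  apply: le_lt_trans (vx _) _ => [s sK|].
    have := vP s; rewrite mem_cat sK => /(_ isT).
    by rewrite lt_min => /andP[_ /ltW].
  by rewrite ltr_pdivrMr// mulrC ltr_pM2l// ltrDl.
have [L [LC [r r0 rP]]] := IH (C `|` [set q]).
exists [seq p <- L | `[< C p >]]; split=> [p|].
  by rewrite mem_filter => /andP[/asboolP].
exists r => // v vP L' L'C.
have [u [uK qu]] : exists u,
    (forall p, p \in [seq p <- L | `[< C p >]] ++ L' -> ev p u = 0) /\ ev q u = 1.
  apply: contrapT => nu; apply: nK; exists ([seq p <- L | `[< C p >]] ++ L').
  split=> [p|u uK].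
    by rewrite mem_cat mem_filter => /orP[/andP[/asboolP]|/L'C].
  apply/eqP/negPn/negP => qu; apply: nu; exists ((ev q u)^-1 *: u).
  by split=> [p pK|]; rewrite evZ; [rewrite (uK _ pK) mulr0|rewrite mulVf].
(* Moving along [u] gives [q] its value at [x] without disturbing the values prescribed on [C]. *)
pose v' := ev q (x - v) *: u + v.
have v'q : ev q v' = ev q x by rewrite ev_lin qu evB; lra.
have v'L p : p \in [seq p <- L | `[< C p >]] ++ L' -> ev p v' = ev p v.
  by move=> pL; rewrite ev_lin uK// mulr0 add0r.
have [p pL|p|z [zL' zF]] := rP v' _ (q :: L') _.
- have [Cp|->] := LC p pL; last by rewrite evB v'q subrr normr0.
  have pK : p \in [seq p <- L | `[< C p >]] by rewrite mem_filter pL andbT; apply/asboolP.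
  by rewrite evB v'L ?mem_cat ?pK// -evB; exact: vP.
- by rewrite inE => /predU1P[->|/L'C]; [right|left].
exists z; split=> [p pL'|p].
  by rewrite zL' ?inE ?pL' ?orbT// v'L// mem_cat pL' orbT.
rewrite inE => /predU1P[->|]; last exact: zF.
by rewrite evB zL' ?mem_head// v'q subrr normr0.
Qed.

(** Rational endpoints leave only countably many boxes over a countable set of functionals. *)
Definition box (l : seq (D * (rat * rat))) : set V :=
  [set x | forall b, b \in l -> ratr b.2.1 < ev b.1 x < ratr b.2.2].

Lemma box_cat l l' x : box l x -> box l' x -> box (l ++ l') x.
Proof. by move=> lx l'x b; rewrite mem_cat => /orP[/lx|/l'x]. Qed.

Lemma box_catP l l' x : box (l ++ l') x -> box l x /\ box l' x.
Proof.
by move=> lx; split=> b bl; apply: lx; rewrite mem_cat bl ?orbT.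
Qed.

Definition weakly_open (U : set V) : Prop :=
  forall x, U x -> exists2 l, box l x & box l `<=` U.

Lemma box_ball l x : box l x -> exists2 e : R, 0 < e &
  forall z, (forall p, p \in unzip1 l -> `|ev p (z - x)| < e) -> box l z.
Proof.
elim: l => [|[p [a b]] l IH] lx; first by exists 1.
have /= /andP[ax xb] := lx _ (mem_head _ _).
have [|e e0 eP] := IH; first by move=> q ql; apply: lx; rewrite inE ql orbT.
exists (Num.min e (Num.min (ev p x - ratr a) (ratr b - ev p x))).
  by rewrite !lt_min e0 !subr_gt0 ax.
move=> z zP q; rewrite inE => /predU1P[->/=|].
  have := zP p (mem_head _ _); rewrite !lt_min => /and3P[_].
  by rewrite evB !ltr_norml; lra.
apply: eP => r rl; have := zP r; rewrite inE rl orbT => /(_ isT).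
by rewrite lt_min => /andP[].
Qed.

Lemma ball_box (L : seq D) (e : R) x : 0 < e -> exists l,
  [/\ unzip1 l = L, box l x &
    forall z, box l z -> forall p, p \in L -> `|ev p (z - x)| < e].
Proof.
move=> e0; elim: L => [|p L [l [lL lx lP]]]; first by exists [::]; split.
have [|a] := @rat_in_itvoo R (ev p x - e) (ev p x); first by lra.
rewrite in_itv/= => /andP[a1 a2].
have [|b] := @rat_in_itvoo R (ev p x) (ev p x + e); first by lra.
rewrite in_itv/= => /andP[b1 b2].
exists ((p, (a, b)) :: l); split=> [|q|z zP q]; first by rewrite /= lL.
  by rewrite inE => /predU1P[->/=|]; [rewrite a2|exact: lx].
rewrite inE => /predU1P[->|]; last first.
  by apply: lP => r rl; apply: zP; rewrite inE rl orbT.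
have /= := zP _ (mem_head _ _).
by rewrite evB ltr_norml; lra.
Qed.

Lemma refine_box_ex (U : set V) : weakly_open U ->
  exists ch : seq (D * (rat * rat)) -> seq (D * (rat * rat)),
  forall l, (box l `&` U) !=set0 ->
    box (ch l) !=set0 /\ box (ch l) `<=` box l `&` U.
Proof.
move=> Uo; pose P l l' := (box l `&` U) !=set0 ->
    box l' !=set0 /\ box l' `<=` box l `&` U.
suff /choice[ch chP] : forall l, exists l', P l l' by exists ch.
move=> l; have [[x [lx Ux]]|] := pselect ((box l `&` U) !=set0); last by exists l.
have [l' l'x l'U] := Uo x Ux; exists (l ++ l') => _; split.
  by exists x; exact: box_cat.
by move=> y /box_catP[ly l'y]; split=> //; exact: l'U.
Qed.

Definition relabel (I : Type) (e : I -> D) (l : seq (I * (rat * rat))) :=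
  [seq (e b.1, b.2) | b <- l].

Section closing_off.
Context (d0 : D) (ch : seq (D * (rat * rat)) -> seq (D * (rat * rat))).

(* The countable type of trees names the smallest set of functionals which is
   closed under [ch]: a node names the [j]-th functional of the refinement of
   the box whose functionals are named by its children. *)
Fixpoint name (t : GenTree.tree nat) : D :=
  match t with
  | GenTree.Leaf _ => d0
  | GenTree.Node k ts =>
    if unpickle k is Some (j, s)
    then (nth (d0, (0, 0)) (ch (zip (map name ts) s)) j).1 else d0
  end.

Lemma named_refinement l : exists l', ch (relabel name l) = relabel name l'.
Proof.
pose s := ch (relabel name l).
exists [seq (GenTree.Node (pickle (j, unzip2 l)) (unzip1 l),
  (nth (d0, (0, 0)) s j).2) | j <- iota 0 (size s)].
rewrite /relabel -map_comp -[LHS](mkseq_nth (d0, (0, 0))) /mkseq.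
apply: eq_map => j /=; rewrite pickleK.
rewrite (_ : zip _ _ = relabel name l) -?surjective_pairing//.
by elim: l {s} => //= b l ->.
Qed.

End closing_off.

(** If every named box around [x] met [U], a small one would contain a named box inside [U]. By
    relative independence some point of [m] has the same values as a point of that box on its
    functionals, and so lies in both [m] and [U]. *)
Lemma exterior_boxes (d0 : D) (U : set V) : weakly_open U ->
  exists e : GenTree.tree nat -> D, forall m x, box m x -> box m `&` U = set0 ->
    exists l, box (relabel e l) x /\ box (relabel e l) `&` U = set0.
Proof.
move=> Uo; have [ch chP] := refine_box_ex Uo; pose e := name d0 ch.
exists e => m x mx mU; have [r r0 rP] := box_ball mx.
have [L [LC [r' r'0 r'P]]] := relative_independence (unzip1 m) (range e) x r0.
have [k [kL kx kP]] := ball_box L x r'0.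
have [l lk] : exists l, relabel e l = k.
  have kC p : p \in unzip1 k -> range e p by rewrite kL; exact: LC.
  elim: k {kL kx kP} kC => [|[p ab] k IH] kC; first by exists [::].
  have [|l lk] := IH; first by move=> q qk; apply: kC; rewrite inE qk orbT.
  have [t _ tp] := kC p (mem_head _ _).
  by exists ((t, ab) :: l); rewrite /= lk tp.
exists l; rewrite lk; split=> //; apply/eqP/negPn/negP => /set0P; rewrite -lk.
move=> /chP; have [l' ->] := named_refinement d0 ch l; rewrite -/e lk.
move=> [[v vl'] l'U].
have [p pL|p|z [zl' zm]] := r'P v _ (unzip1 (relabel e l')) _.
- by apply: kP => //; have [] := l'U _ vl'.
- by move=> /mapP[_ /mapP[b _ ->] ->]; exists b.1.
have l'z : box (relabel e l') z.
  by move=> b bl'; rewrite zl'; [exact: vl'|exact: map_f].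
have : (box m `&` U) z by split; [exact: rP|have [] := l'U _ l'z].
by rewrite mU.
Qed.

Definition cylinders : set (set V) := range (fun b => box [:: b]).

Lemma sigma_algebra_box l : <<s cylinders >> (box l).
Proof.
elim: l => [|b l IH].
  rewrite (_ : box [::] = setT `\` set0).
    by apply: sigma_algebraCD; exact: sigma_algebra0.
  by apply/seteqP; split=> x _; [split|move=> b].
rewrite (_ : box (b :: l) = box [:: b] `&` box l).
  apply: (@sigma_algebra_setI _ <<s cylinders >>) => //.
  by apply: sub_sigma_algebra; exists b.
apply/seteqP; split=> [x /(@box_catP [:: b] l)//|x [bx lx]].
exact: (@box_cat [:: b] l).
Qed.

(** [f x <= t] holds iff for each rational [q > t] the point [x] has a named box disjoint from the
    set where [f > q]: a box inside the set where [f < q] is replaced by a named one through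
    [exterior_boxes]. *)
Lemma weakly_continuous_measurable (d0 : D) (f : V -> R) :
  (forall t, weakly_open [set x | t < f x]) ->
  (forall t, weakly_open [set x | f x < t]) ->
  forall t, <<s cylinders >> [set x | f x <= t].
Proof.
move=> fgt flt t.
have /choice[e eP] : forall q : rat, exists e : GenTree.tree nat -> D,
    forall m x, box m x -> box m `&` [set y | ratr q < f y] = set0 ->
    exists l, box (relabel e l) x /\
      box (relabel e l) `&` [set y | ratr q < f y] = set0.
  by move=> q; exact: exterior_boxes.
pose G q l : set V :=
  if pselect (box (relabel (e q) l) `&` [set y | ratr q < f y] = set0)
  then box (relabel (e q) l) else set0.
pose W q := [set x | exists l, G q l x].
have mW q : <<s cylinders >> (W q).
  apply: (@sigma_algebra_ex _ _ <<s cylinders >> (G q)) => // l.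
  rewrite /G; case: pselect => ?; first exact: sigma_algebra_box.
  exact: sigma_algebra0.
rewrite (_ : [set _ | _] = setT `\` [set x | exists q : rat,
    (if t < ratr q then setT `\` W q else set0) x]).
  apply: sigma_algebraCD.
  apply: (@sigma_algebra_ex _ _ <<s cylinders >>
    (fun q => if t < ratr q then setT `\` W q else set0)) => // q.
  by case: ifP => _; [exact: sigma_algebraCD|exact: sigma_algebra0].
apply/seteqP; split=> [x /= fxt|x [_ nx]].
  split=> // -[q]; case: ifP => // tq [_]; apply.
  have [m mx mU] := flt (ratr q) x (le_lt_trans fxt tq).
  have [|l [lx lU]] := eP q m x mx.
    by rewrite -subset0 => y [/mU /= fyq /(lt_trans fyq)]; rewrite ltxx.
  by exists l; rewrite /G; case: pselect.
rewrite /= leNgt; apply/negP => tfx.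
have [q] := rat_in_itvoo tfx; rewrite in_itv/= => /andP[tq qf].
apply: nx; exists q; rewrite tq; split=> // -[l]; rewrite /G.
case: pselect => // lU lx; suff : (set0 : set V) x by [].
by rewrite -lU.
Qed.

End functionals.

(** * Edgar's theorem on the Baire sets of the weak topology *)

Section weak_Baire.
Context (R : realType) (X : normedModType R).

Definition dual_ev (phi : {classic (dual X)}) (x : X) : R :=
  sval (phi : dual X) x.

Lemma dual_ev_lin phi a x y :
  dual_ev phi (a *: x + y) = a * dual_ev phi x + dual_ev phi y.
Proof. by rewrite /dual_ev linearP. Qed.

Lemma zero_continuous : continuous (\0 : {linear X -> R | *%R}).
Proof. exact: cst_continuous. Qed.

Definition dual0 : dual X := exist _ _ zero_continuous.

(** The boxes around [x] generate a filter that converges to [x] in each initial topology, hence in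
    their supremum, and so contains every open neighbourhood of [x]. *)
Lemma open_weakly_open (U : set (weak X)) : open U -> weakly_open dual_ev U.
Proof.
move=> oU x Ux.
pose F : set_system X := [set A | exists2 l, box dual_ev l x & box dual_ev l `<=` A].
have FF : Filter F.
  split=> [|A B [l lx lA] [m mx mB]|A B AB [l lx lA]].
  - by exists [::].
  - exists (l ++ m); first exact: box_cat.
    by move=> y /box_catP[/lA ? /mB].
  - by exists l => //; exact: subset_trans AB.
have : F --> (x : weak X).
  apply/cvg_sup => phi A /= [_ [[B oB <-] Bx] BA].
  have /nbhs_ballP[e /= e0 eB] : nbhs (sval phi x) B by exact: open_nbhs_nbhs.
  have [l [_ lx lP]] := ball_box dual_ev_lin
    [:: phi : {classic (dual X)}] (x : X) e0.
  exists l => // y ly; apply: BA; apply: eB; rewrite /ball/= distrC.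
  have := lP y ly phi (mem_head _ _).
  by rewrite /dual_ev raddfB.
by apply; exact: open_nbhs_nbhs.
Qed.

Lemma Ba_cylinders (B : set (Ba X)) : measurable B ->
  <<s cylinders dual_ev >> B.
Proof.
move: B; apply: smallest_sub => // _ [f fc [B mB <-]]; rewrite setTI.
suff sub : @measurable _ R `<=`
    [set B | <<s cylinders dual_ev >> (f @^-1` B)] by exact: sub.
have -> : @measurable _ R = <<s @RGenOInfty.G R >>.
  exact: RGenOInfty.measurableE.
apply: smallest_sub.
  exact: sigma_algebra_pullback.
move=> _ [t ->] /=.
rewrite (_ : _ @^-1` _ = setT `\` [set x | f x <= t]); last first.
  apply/seteqP; split=> x /=; rewrite in_itv/= andbT ltNge.
    by move=> /negP.
  by move=> [_ /negP].
apply: sigma_algebraCD.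
apply: (weakly_continuous_measurable dual_ev_lin (dual0 : {classic (dual X)})) => u.
  by have := open_weakly_open (open_comp (fun x _ => fc x) (@open_gt _ u)).
by have := open_weakly_open (open_comp (fun x _ => fc x) (@open_lt _ u)).
Qed.

End weak_Baire.

(** * Coding a subset of the square by a norm *)

Section biorthogonal.
Context (R : realType) (X : normedModType R) (K : choiceType).
Context (e : K -> X) (phi : K -> {scalar X}).
Hypothesis phiE : forall c a, phi c (e a) = (c == a)%:R.
Hypothesis phi_le : forall c x, `|phi c x| <= 2 * `|x|.
Hypothesis e_le : forall a, `|e a| <= 1.

(** With the same weights in [coding_norm], for [a != b] the pair [(a, b)] yields 1 + 4 = 5 and the
    reversed pair 2 + 2 = 4, so order is detected. *)
Let test (ab : K * K) : X := e ab.1 + 2 *: e ab.2.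

(** By Edgar's theorem only cylinders matter, and [p < f a + 2 * f b < q] is a countable union of
    rectangles with rational bounds on [f a] and [f b]. *)
Lemma measurable_test (B : set (Ba X)) : measurable B ->
  <<s rectangles K >> (test @^-1` B).
Proof.
move=> /Ba_cylinders; move: B; apply: (@smallest_sub _ _ _
  [set B | <<s rectangles K >> (test @^-1` B)]).
  exact: sigma_algebra_pullback.
move=> _ [[psi [p q]] _ <-] /=.
pose f a : R := dual_ev psi (e a).
pose F (r : rat * rat * (rat * rat)) : set (K * K) :=
  if (p <= r.1.1 + 2 * r.2.1) && (r.1.2 + 2 * r.2.2 <= q)
  then [set a | ratr r.1.1 < f a < ratr r.1.2] `*`
       [set b | ratr r.2.1 < f b < ratr r.2.2] else set0.
rewrite (_ : _ @^-1` _ = [set ab | exists r, F r ab]).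
  apply: (@sigma_algebra_ex _ _ <<s rectangles K >>) => // r.
  rewrite /F; case: ifP => _; last exact: sigma_algebra0.
  apply: sub_sigma_algebra.
  exists [set a | ratr r.1.1 < f a < ratr r.1.2] => //.
  by exists [set b | ratr r.2.1 < f b < ratr r.2.2].
have testE ab : dual_ev psi (test ab) = f ab.1 + 2 * f ab.2.
  rewrite /test addrC dual_ev_lin addrC//.
have ratrE (r s : rat) : ratr (r + 2 * s) = ratr r + 2 * ratr s :> R.
  by rewrite rmorphD rmorphM/= ratr_nat.
apply/seteqP; split=> [ab lab|ab [r]].
  have := lab _ (mem_head _ _); rewrite /= testE => /andP[].
  set x := f ab.1; set y := f ab.2 => px xq.
  (* Errors below [d] in [x] and in [y] change [x + 2 * y] by less than [3 * d]. *)
  pose d := Num.min (x + 2 * y - ratr p) (ratr q - (x + 2 * y)) / 3.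
  have d0 : 0 < d by rewrite divr_gt0// lt_min !subr_gt0 px.
  have /andP[d1 d2] : (3 * d <= x + 2 * y - ratr p) && (3 * d <= ratr q - (x + 2 * y)).
    by rewrite -le_min /d mulrCA divff// mulr1.
  have [|r1] := @rat_in_itvoo R (x - d) x; first by lra.
  have [|r2] := @rat_in_itvoo R x (x + d); first by lra.
  have [|r3] := @rat_in_itvoo R (y - d) y; first by lra.
  have [|r4] := @rat_in_itvoo R y (y + d); first by lra.
  rewrite !in_itv/= => /andP[r41 r42] /andP[r31 r32] /andP[r21 r22] /andP[r11 r12].
  exists (r1, r2, (r3, r4)); rewrite /F/=.
  rewrite -(ler_rat R) -[X in _ && X](ler_rat R) !ratrE.
  case: ifPn => [_|/negP]; first by split; rewrite /= -/x -/y; lra.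
  by case; lra.
rewrite /F; case: ifP => // /andP[]; rewrite -(ler_rat R) -(ler_rat R (_ + _) q) !ratrE.
move=> pr rq [/= /andP[r1 r2] /andP[r3 r4]] b; rewrite inE => /eqP ->.
by rewrite /= testE; lra.
Qed.

Section coding_norm.
Context (D : set (K * K)).

Let values (x : X) : set R :=
  [set r | r = `|x| \/ exists2 cd, D cd & r = `|phi cd.1 x + 2 * phi cd.2 x|].

Definition coding_norm (x : X) : R := sup (values x).

Let has_sup_values x : has_sup (values x).
Proof.
split; first by exists `|x|; left.
(* [phi_le] gives 2 + 2 * 2 = 6. *)
exists (6 * `|x|) => r [->|[cd _ ->]]; first by have := normr_ge0 x; lra.
have := ler_normD (phi cd.1 x) (2 * phi cd.2 x).
rewrite normrM [`|2|]ger0_norm//.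
by have := phi_le cd.1 x; have := phi_le cd.2 x; lra.
Qed.

Lemma coding_norm_ge_norm x : `|x| <= coding_norm x.
Proof. by apply: sup_upper_bound => //; left. Qed.

Lemma coding_norm_ge x c d : D (c, d) ->
  `|phi c x + 2 * phi d x| <= coding_norm x.
Proof. by move=> Dcd; apply: sup_upper_bound => //; right; exists (c, d). Qed.

Lemma coding_norm_le x M : `|x| <= M ->
  (forall c d, D (c, d) -> `|phi c x + 2 * phi d x| <= M) -> coding_norm x <= M.
Proof.
move=> xM DM; apply: ge_sup; first by case: (has_sup_values x).
by move=> _ [->//|[[c d] Dcd ->]]; exact: DM.
Qed.

Lemma equivalent_coding_norm : equivalent_norm coding_norm.
Proof.
have scale_le a x : coding_norm (a *: x) <= `|a| * coding_norm x.
  apply: coding_norm_le => [|c d Dcd].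
    by rewrite normrZ ler_wpM2l// coding_norm_ge_norm.
  rewrite !linearZ/= mulrCA -mulrDr normrM ler_wpM2l//.
  exact: coding_norm_ge.
split; first split.
- move=> x y; apply: coding_norm_le => [|c d Dcd].
    by rewrite (le_trans (ler_normD _ _))// lerD// coding_norm_ge_norm.
  rewrite !linearD/= mulrDr addrACA (le_trans (ler_normD _ _))//.
  by rewrite lerD// coding_norm_ge.
- move=> a x; apply/eqP; rewrite eq_le scale_le/=.
  have [->|a0] := eqVneq a 0.
    rewrite normr0 mul0r scale0r.
    by rewrite (le_trans (normr_ge0 _) (coding_norm_ge_norm _)).
  rewrite -ler_pdivlMl ?normr_gt0// -normfV (le_trans _ (scale_le _ _))//.
  by rewrite scalerA mulVf// scale1r.
- move=> x x0; apply/eqP; rewrite -normr_le0 -x0; exact: coding_norm_ge_norm.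
exists 1, 6; split=> // x; rewrite mul1r coding_norm_ge_norm/=.
apply: ge_sup => [|r]; first by case: (has_sup_values x).
move=> [->|[cd _ ->]]; first by have := normr_ge0 x; lra.
have := ler_normD (phi cd.1 x) (2 * phi cd.2 x).
rewrite normrM [`|2|]ger0_norm//.
by have := phi_le cd.1 x; have := phi_le cd.2 x; lra.
Qed.

(** For [a != b], off-diagonal pairs other than [(a, b)] contribute at most 4, and the original norm
    at most 3. For [a = b] a pair ending in [a] contributes 6 and all others at most 3, so the value
    5 is skipped. *)
Lemma coding_norm_test a b : (forall c, ~ D (c, c)) ->
  coding_norm (test (a, b)) = 5 <-> D (a, b).
Proof.
move=> nDcc.
have testE c d : phi c (test (a, b)) + 2 * phi d (test (a, b)) =
    ((c == a) + 2 * (c == b) + 2 * ((d == a) + 2 * (d == b)))%N%:R.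
  by rewrite !linearD !linearZ/= !phiE !(natrD, natrM).
have t3 : `|test (a, b)| <= 3.
  rewrite (le_trans (ler_normD _ _))// normrZ [`|2|]ger0_norm//.
  by have := e_le a; have := e_le b; rewrite /=; lra.
have bound (m : nat) : (3 <= m)%N -> (forall c d, D (c, d) ->
    ((c == a) + 2 * (c == b) + 2 * ((d == a) + 2 * (d == b)) <= m)%N) ->
    coding_norm (test (a, b)) <= m%:R.
  move=> m3 Dm; apply: coding_norm_le => [|c d Dcd].
    by rewrite (le_trans t3)// ler_nat.
  by rewrite testE ger0_norm// ler_nat; exact: Dm.
have [ba|ab] := eqVneq a b.
  rewrite -{}ba in testE bound *; split=> [N5|/nDcc//]; exfalso.
  have [[c Dca]|nDa] := pselect (exists c, D (c, a)).
    have ca : (c == a) = false by apply/eqP => ca; apply: (nDcc a); rewrite -{1}ca.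
    have := @coding_norm_ge (test (a, a)) _ _ Dca.
    by rewrite testE !eqxx ca ger0_norm// N5 ler_nat.
  suff : coding_norm (test (a, a)) <= 3 by rewrite N5 ler_nat.
  apply: (bound 3%N) => // c d Dcd.
  have -> : (d == a) = false by apply/eqP => da; apply: nDa; exists c; rewrite -da.
  by case: eqP.
have ba : (b == a) = false by rewrite eq_sym; exact: negbTE.
split=> [N5|Dab].
  apply: contrapT => nDab.
  suff : coding_norm (test (a, b)) <= 4 by rewrite N5 ler_nat.
  apply: (bound 4%N) => // c d Dcd.
  case: (eqVneq c a) Dcd => [->|ca] Dcd.
    case: (eqVneq d b) Dcd => [->//|db] Dcd.
    case: (eqVneq d a) Dcd => [->|da] Dcd; first by have := nDcc a.
    by rewrite (negPf ab).
  case: (eqVneq c b) Dcd => [->|cb] Dcd; last first.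
    by case: (eqVneq d b) => [->|db]; [rewrite ba|case: eqP].
  case: (eqVneq d b) Dcd => [->|db] Dcd; first by have := nDcc b.
  by case: eqP.
apply/eqP; rewrite eq_le; apply/andP; split.
  apply: (bound 5%N) => // c d Dcd.
  case: (eqVneq c a) Dcd => [->|ca] Dcd.
    rewrite (negPf ab); case: (eqVneq d a) Dcd => [->|da] Dcd.
      by have := nDcc a.
    by case: eqP.
  case: (eqVneq c b) Dcd => [->|cb] Dcd.
    case: (eqVneq d b) Dcd => [->|db] Dcd; first by have := nDcc b.
    by case: eqP.
  by case: (eqVneq d a) => [->|da]; [rewrite (negPf ab)|case: eqP].
have := @coding_norm_ge (test (a, b)) _ _ Dab.
by rewrite testE !eqxx ba (negPf ab) ger0_norm.
Qed.

End coding_norm.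

(** An off-diagonal set is the preimage under [test] of a level set of its coding norm. The diagonal
    is then the complement of such a set, and a rectangle cuts out of it the diagonal part of
    [D]. *)
Lemma Kunen_of_measurable_norms :
  (forall N : X -> R, equivalent_norm N -> Ba_measurable N) -> Kunen_cardinal K.
Proof.
move=> mN; apply/seteqP; split=> // D _; rewrite -/(rectangles K).
have off_diagonal (E : set (K * K)) : (forall c, ~ E (c, c)) ->
    <<s rectangles K >> E.
  move=> Ecc; have mE : measurable ([set x | coding_norm E x = 5] : set (Ba X)).
    rewrite -[X in measurable X]setTI.
    have : measurable [set (5 : R)] by [].
    exact: (mN _ (equivalent_coding_norm E)).
  have := measurable_test mE; congr (<<s _ >> _).
  apply/seteqP; split=> [[a b] /=|[a b] Eab]; first by move/coding_norm_test; apply.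
  exact/coding_norm_test.
have diag : <<s rectangles K >> [set ab : K * K | ab.1 = ab.2].
  have := off_diagonal [set ab : K * K | ab.1 <> ab.2].
  move=> /(_ (fun c cc => cc erefl)) /(@sigma_algebraCD _ setT); congr (<<s _ >> _).
  apply/seteqP; split=> [[a b] /= [_ /contrapT]//|[a b] /= ab].
  by split.
rewrite (_ : D = [set x | exists b : bool, (if b
    then [set ab : K * K | ab.1 = ab.2] `&` ([set a | D (a, a)] `*` setT)
    else [set ab | D ab /\ ab.1 <> ab.2]) x]).
  apply: sigma_algebra_ex => // -[].
    apply: (@sigma_algebra_setI _ <<s rectangles K >>) => //; apply: sub_sigma_algebra.
    by exists [set a | D (a, a)] => //; exists setT.
  by apply: off_diagonal => c [].
apply/seteqP; split=> [[a b] Dab|[a b] [[]/=]].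
- have [ab|ab] := pselect (a = b); last by exists false.
  by subst b; exists true.
- by move=> [/= ->] [].
- by move=> [].
Qed.

End biorthogonal.

(** * Norming families of functionals indexed by the Cantor cube *)

Section norming_functionals.
Context (R : realType) (X : normedModType R) (K : choiceType).
Context (phi : (K -> bool) -> {scalar X}) (M : R).
Hypothesis phi_unif : forall x (e : R), 0 < e -> exists F : seq K,
  forall s t, (forall a, a \in F -> s a = t a) -> `|phi s x - phi t x| < e.
Hypothesis phi_le : forall s x, `|phi s x| <= `|x|.
Hypothesis M_gt0 : 0 < M.
Hypothesis norming : forall x r, (forall s, `|phi s x| <= r) -> `|x| <= M * r.

Lemma bounded_scalar_continuous (psi : {scalar X}) :
  (forall x, `|psi x| <= `|x|) -> continuous psi.
Proof.
move=> psi_le x; apply/cvgrPdist_lt => e e0.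
have : \forall z \near x, `|x - z| < e by exact: (@cvgr_dist_lt _ _ _ (nbhs x) _ id).
by apply: filterS => z; apply: le_lt_trans; rewrite -linearB psi_le.
Qed.

Lemma continuous_scalar_measurable (psi : {scalar X}) : continuous psi ->
  measurable_fun [set: Ba X] (psi : Ba X -> R).
Proof.
move=> psic _ B mB; apply: sub_sigma_algebra; exists (psi : weak X -> R).
  move=> x.
  have /cvg_sup/(_ (exist _ psi psic)) h :
    nbhs (x : weak X) --> (x : weak X) by [].
  apply: cvg_trans (@initial_continuous _ _ (psi : X -> R) x).
  exact: cvg_app h.
by exists B.
Qed.

(** Strict sublevel sets of [N] are open for uniform closeness of the values of [phi], because the
    family is norming and [N] is dominated by the norm. *)
Lemma Kunen_Ba_measurable : Kunen_cardinal K ->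
  forall N : X -> R, equivalent_norm N -> Ba_measurable N.
Proof.
move=> KK N [[ND NZ N0] [c [C [c0 C0 Nle]]]].
have [H H_sep] := Kunen_separating KK.
apply: (measurability _ (RGenInftyO.measurableE R)) => _ /= [_ [t ->] <-].
rewrite setTI.
apply: (@measurable_uniform_open R K _ (Ba X) (fun x s => phi s x) phi_unif
  _ H H_sep) => [s||x].
- by apply: continuous_scalar_measurable; exact: bounded_scalar_continuous.
- exact: Kunen_seq.
(* Multiplied by [C * M], this radius is half of the gap [t - N x]. *)
rewrite /= in_itv/= => xt; exists ((t - N x) / 2 / (C * M)).
  by rewrite !divr_gt0 ?mulr_gt0// subr_gt0.
move=> y yP; rewrite /= in_itv/=.
have : `|(y : X) - x| <= M * ((t - N x) / 2 / (C * M)).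
  by apply: norming => s; rewrite linearB.
have -> : M * ((t - N x) / 2 / (C * M)) = (t - N x) / 2 / C.
  by field; rewrite !gt_eqF.
rewrite ler_pdivlMr// mulrC.
have := ND x ((y : X) - x); rewrite addrC subrK.
have /andP[_] := Nle ((y : X) - x).
lra.
Qed.

End norming_functionals.

(** * The Cantor cube *)

Section Cantor_cube.
Context (R : realType) (K : choiceType).

Lemma nbhs_cylinder (x : cantor_cube K) (F : seq K) :
  nbhs x [set s : cantor_cube K | forall a, a \in F -> s a = x a].
Proof.
elim: F => [|a F IH]; first by apply: filterS filterT.
have xa : nbhs x [set s : cantor_cube K | s a = x a].
  have : nbhs (x a) [set x a] by exact: discrete_set1.
  exact: (@proj_continuous K (fun=> bool) a x).
apply: filterS (filterI xa IH) => s [sa sF] b.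
by rewrite inE => /predU1P[->|/sF].
Qed.

Lemma cylinder_nbhs (x : cantor_cube K) (U : set (cantor_cube K)) : nbhs x U ->
  exists F : seq K, forall s : cantor_cube K,
    (forall a, a \in F -> s a = x a) -> U s.
Proof.
pose G : set_system (cantor_cube K) := [set A | exists F : seq K,
  forall s : cantor_cube K, (forall a, a \in F -> s a = x a) -> A s].
have FG : Filter G.
  split=> [|A B [F FA] [F' FB]|A B AB [F FA]].
  - by exists [::].
  - exists (F ++ F') => s sx; split; [apply: FA|apply: FB] => a aF;
      by apply: sx; rewrite mem_cat aF ?orbT.
  - by exists F => s /FA /AB.
suff : G --> x by apply.
apply/cvg_sup => a A /= [_ [[B oB <-] Bx] BA].
exists [:: a] => s sx; apply: BA.
by rewrite /preimage/= (sx a (mem_head _ _)).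
Qed.

(** Uniform continuity by compactness, in near-covering form along the finite sets of coordinates
    directed by inclusion. *)
Lemma C_cube_unif (f : C_cube R K) (e : R) : 0 < e -> exists F : seq K,
  forall s t : K -> bool, (forall a, a \in F -> s a = t a) -> `|f s - f t| < e.
Proof.
move=> e0.
pose G : set_system (seq K) := [set A | exists F : seq K,
  forall F' : seq K, {subset F <= F'} -> A F'].
have FG : Filter G.
  split=> [|A B [F FA] [F' FB]|A B AB [F FA]].
  - by exists [::].
  - exists (F ++ F') => L FL; split; [apply: FA|apply: FB] => a aF;
      by apply: FL; rewrite mem_cat aF ?orbT.
  - by exists F => L /FA /AB.
pose P (F : seq K) (s : cantor_cube K) := forall t : K -> bool,
  (forall a, a \in F -> s a = t a) -> `|f s - f t| < e.
have /compact_near_coveringP/(_ _ G P FG) := @cantor_cube_compact K.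
move=> [x _|F FP]; last first.
  by exists F => s t st; exact: (FP F (fun _ h => h) s I).
have e20 : 0 < e / 2 by rewrite divr_gt0.
have /cylinder_nbhs[F FP] : nbhs x [set s | `|f x - f s| < e / 2].
  have /cvgrPdist_lt/(_ _ e20) : f s @[s --> x] --> f x by exact: cts_fun.
  by [].
exists ([set s | forall a, a \in F -> s a = x a],
  [set L : seq K | {subset F <= L}]); first split=> /=.
- exact: nbhs_cylinder.
- by exists F.
move=> [s L] [/= sx FL] t st.
have := FP _ sx; rewrite /= distrC => fs.
have ft : `|f x - f t| < e / 2.
  by apply: FP => a aF; rewrite -st ?sx// FL.
have := ler_normD (f s - f x) (f x - f t).
by rewrite addrA subrK; move: fs ft; lra.
Qed.

Definition C_eval (s : K -> bool) (f : C_cube R K) : R := f s.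

Lemma C_eval_linear s : linear_for *%R (C_eval s).
Proof. by []. Qed.

HB.instance Definition _ s := GRing.isLinear.Build R (C_cube R K) R *%R
  (C_eval s) (C_eval_linear s).

Lemma Kunen_C_cube : Kunen_cardinal K ->
  forall N : C_cube R K -> R, equivalent_norm N -> Ba_measurable N.
Proof.
apply: (@Kunen_Ba_measurable R (C_cube R K) K C_eval 1) => //.
- exact: C_cube_unif.
- by move=> s x; exact: ler_sup_norm.
- by move=> x r xr; rewrite mul1r; exact: sup_norm_le.
Qed.

Lemma coordinate_continuous (a : K) :
  continuous (fun s : cantor_cube K => (s a)%:R : R).
Proof.
move=> s U /nbhs_singleton Us.
apply: filterS (nbhs_cylinder s [:: a]) => t /(_ a (mem_head _ _)) ta.
by rewrite /preimage/= ta.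
Qed.

Definition C_coordinate (a : K) : C_cube R K := mkcts (@coordinate_continuous a).

(** Biorthogonal to the coordinate functions; a difference of two evaluations has norm at most 2,
    the constant allowed in [phi_le]. *)
Definition C_increment (c : K) (f : C_cube R K) : R :=
  f (fun a => a == c) - f (fun=> false).

Lemma C_increment_linear c : linear_for *%R (C_increment c).
Proof.
move=> a f g; rewrite /C_increment.
have fE s : (a *: f + g : C_cube R K) s = a * f s + g s by [].
by rewrite !fE mulrBr opprD addrACA.
Qed.

HB.instance Definition _ c := GRing.isLinear.Build R (C_cube R K) R *%R
  (C_increment c) (C_increment_linear c).

Lemma C_cube_Kunen :
  (forall N : C_cube R K -> R, equivalent_norm N -> Ba_measurable N) ->
  Kunen_cardinal K.
Proof.
apply: (@Kunen_of_measurable_norms R (C_cube R K) K C_coordinate C_increment).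
- by move=> c a; rewrite -[LHS]/((a == c)%:R - 0) subr0 eq_sym.
- move=> c f; rewrite (le_trans (ler_normB _ _))//.
  have := ler_sup_norm f (fun a => a == c); have := ler_sup_norm f (fun=> false).
  by rewrite -[`|f|]/(sup_norm f); lra.
- move=> a; apply: sup_norm_le => s /=; rewrite /mkcts.
  by rewrite ger0_norm ?ler0n// lern1 leq_b1.
Qed.

End Cantor_cube.

(** * The space of summable families *)

Section unconditional_sums.
Context (R : realType) (K : choiceType).
Implicit Types f g h u v : K -> R.

Definition nnsummable f : Prop :=
  (forall k, 0 <= f k) /\ (\esum_(k in [set: K]) (f k)%:E < +oo)%E.

Definition nnsum f : R := fine (\esum_(k in [set: K]) (f k)%:E)%E.

Lemma nnsumE f : nnsummable f ->
  ((nnsum f)%:E = \esum_(k in [set: K]) (f k)%:E)%E.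
Proof.
move=> [f0 foo]; rewrite /nnsum fineK// ge0_fin_numE//.
by apply: esum_ge0 => k _; rewrite lee_fin.
Qed.

Lemma nnsummable_le f g : (forall k, 0 <= f k <= g k) -> nnsummable g ->
  nnsummable f.
Proof.
move=> fg [g0 goo]; split=> [k|]; first by have /andP[] := fg k.
apply: le_lt_trans goo; apply: le_esum => k _; rewrite lee_fin.
by have /andP[] := fg k.
Qed.

Lemma le_nnsum f g : (forall k, 0 <= f k <= g k) -> nnsummable g ->
  nnsum f <= nnsum g.
Proof.
move=> fg ng; rewrite -lee_fin !nnsumE//; last exact: nnsummable_le ng.
by apply: le_esum => k _; rewrite lee_fin; have /andP[] := fg k.
Qed.

Lemma nnsum_ge0 f : nnsummable f -> 0 <= nnsum f.
Proof.
move=> nf; rewrite -lee_fin nnsumE//; apply: esum_ge0 => k _.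
by rewrite lee_fin; case: nf.
Qed.

Lemma nnsummableD f g : nnsummable f -> nnsummable g ->
  nnsummable (fun k => f k + g k) /\
  nnsum (fun k => f k + g k) = nnsum f + nnsum g.
Proof.
move=> nf ng; have [f0 foo] := nf; have [g0 goo] := ng.
have e : (\esum_(k in [set: K]) (f k + g k)%:E = (nnsum f + nnsum g)%:E)%E.
  rewrite EFinD !nnsumE// -esumD// => k _; by rewrite lee_fin.
by split; [split=> [k|]; rewrite ?e ?ltry ?addr_ge0|rewrite /nnsum e].
Qed.

Lemma nnsummableZ a f : 0 <= a -> nnsummable f ->
  nnsummable (fun k => a * f k) /\ nnsum (fun k => a * f k) = a * nnsum f.
Proof.
have le b h : 0 <= b -> nnsummable h ->
    nnsummable (fun k => b * h k) /\ nnsum (fun k => b * h k) <= b * nnsum h.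
  move=> b0 nh; have [h0 hoo] := nh.
  have bh : (\esum_(k in [set: K]) (b * h k)%:E <= (b * nnsum h)%:E)%E.
    rewrite EFinM nnsumE//; apply: ge_ereal_sup => _ [A [finA _] <-].
    under eq_fsbigr do rewrite EFinM.
    rewrite fsbig_finite//= -ge0_sume_distrr//; last by move=> *; rewrite lee_fin.
    rewrite lee_wpmul2l ?lee_fin//; apply: esum_ge; exists A => //.
    by rewrite fsbig_finite.
  have nbh : nnsummable (fun k => b * h k).
    split=> [k|]; first exact: mulr_ge0.
    by rewrite (le_lt_trans bh)// ltry.
  by split=> //; rewrite -lee_fin nnsumE.
move=> a0 nf; have [naf af] := le a f a0 nf; split=> //; apply/eqP.
rewrite eq_le af/=; have [a00|an0] := eqVneq a 0.
  by rewrite {1}a00 mul0r; exact: nnsum_ge0.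
have [|_] := le a^-1 _ _ naf; first by rewrite invr_ge0.
under eq_fun do rewrite mulrA mulVf// mul1r.
by rewrite ler_pdivlMl// lt_neqAle eq_sym an0.
Qed.

(* The sum of an absolutely summable family, written as a difference of sums of
   nonnegative families because [esum] is meaningful only for these. *)
Definition ell1_sum h : R :=
  nnsum (fun k => `|h k| + h k) - nnsum (fun k => `|h k|).

Lemma nnsummable_shift h : nnsummable (fun k => `|h k|) ->
  nnsummable (fun k => `|h k| + h k).
Proof.
move=> nh; have [n2 _] := nnsummableD nh nh.
apply: nnsummable_le n2 => k; have := ler_norm (h k).
by have := ler_norm (- h k); rewrite normrN; lra.
Qed.

(** Every decomposition gives the same sum: [|h| + h + v] and [|h| + u] are the same family, summed
    in two ways. *)
Lemma ell1_sumB u v : nnsummable u -> nnsummable v ->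
  ell1_sum (fun k => u k - v k) = nnsum u - nnsum v.
Proof.
move=> nu nv; set h := fun k => u k - v k.
have nh : nnsummable (fun k => `|h k|).
  have [nuv _] := nnsummableD nu nv; apply: nnsummable_le nuv => k.
  have [[u0 _] [v0 _]] := (nu, nv).
  rewrite normr_ge0/= (le_trans (ler_normB _ _))//.
  by rewrite !ger0_norm.
have [_ e1] := nnsummableD (nnsummable_shift nh) nv.
have [_ e2] := nnsummableD nh nu.
suff : nnsum (fun k => `|h k| + h k + v k) = nnsum (fun k => `|h k| + u k).
  by rewrite e1 e2 /ell1_sum; lra.
by congr nnsum; apply/funext => k; rewrite /h -addrA subrK.
Qed.

Lemma ell1_sum_linear a f g :
  nnsummable (fun k => `|f k|) -> nnsummable (fun k => `|g k|) ->
  ell1_sum (fun k => a * f k + g k) = a * ell1_sum f + ell1_sum g.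
Proof.
move=> nf ng.
have sf := nnsummable_shift nf; have sg := nnsummable_shift ng.
have [a0|/ltW a0] := leP 0 a.
  have [nu1 u1] := nnsummableZ a0 sf; have [nv1 v1] := nnsummableZ a0 nf.
  have [nu u] := nnsummableD nu1 sg; have [nv v] := nnsummableD nv1 ng.
  rewrite (_ : (fun k => _) = (fun k => a * (`|f k| + f k) + (`|g k| + g k) -
      (a * `|f k| + `|g k|))); last by apply/funext => k; lra.
  by rewrite (ell1_sumB nu nv) u v u1 v1 /ell1_sum; lra.
have b0 : 0 <= - a by rewrite oppr_ge0.
have [nu1 u1] := nnsummableZ b0 nf; have [nv1 v1] := nnsummableZ b0 sf.
have [nu u] := nnsummableD nu1 sg; have [nv v] := nnsummableD nv1 ng.
rewrite (_ : (fun k => _) = (fun k => - a * `|f k| + (`|g k| + g k) -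
    (- a * (`|f k| + f k) + `|g k|))); last by apply/funext => k; lra.
by rewrite (ell1_sumB nu nv) u v u1 v1 /ell1_sum; lra.
Qed.

Lemma ell1_sum_le h : nnsummable (fun k => `|h k|) ->
  `|ell1_sum h| <= nnsum (fun k => `|h k|).
Proof.
move=> nh; have := nnsum_ge0 (nnsummable_shift nh).
have [n2 e2] := nnsummableD nh nh.
have : nnsum (fun k => `|h k| + h k) <= nnsum (fun k => `|h k| + `|h k|).
  apply: le_nnsum => // k; have := ler_norm (h k).
  by have := ler_norm (- h k); rewrite normrN; lra.
by rewrite e2 /ell1_sum ler_norml; lra.
Qed.

Lemma nnsum_tail f (e : R) : nnsummable f -> 0 < e -> exists F : seq K,
  nnsum (fun k => if k \in F then 0 else f k) < e.
Proof.
move=> nf e0; have [f0 foo] := nf.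
have fE := nnsumE nf.
have : ((nnsum f - e)%:E < \esum_(k in [set: K]) (f k)%:E)%E.
  by rewrite -fE lte_fin; lra.
move=> /ereal_sup_gt[_ [A [finA _] <-] Ae].
have [F FE] := (finite_seqP A).1 finA.
exists F; rewrite -lte_fin nnsumE; last first.
  by apply: nnsummable_le nf => k; case: ifP => _; rewrite ?lexx ?f0.
have fE0 k : (0 <= (f k)%:E)%E by rewrite lee_fin.
have := @esumID R K A [set: K] _ (fun k _ => fE0 k).
rewrite -fE setTI esum_fset// setTI.
rewrite (_ : (\esum_(i in ~` A) _)%E =
    (\esum_(k in [set: K]) (if k \in F then 0 else f k)%:E)%E).
  set y := (\esum_(k in [set: K]) _)%E; move: Ae.
  set z := (\sum_(k \in A) _)%E.
  case: z => [z| |]//; case: y => [y| |]//.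
  by rewrite -EFinD lte_fin => ? [?]; rewrite lte_fin; lra.
rewrite esum_mkcond; apply: eq_esum => k _.
rewrite FE; case: ifPn => [/set_mem/= nF|/negP nF]; case: ifPn => kF //.
by exfalso; apply: nF; apply/mem_set; exact/negP.
Qed.

End unconditional_sums.

Section ell1_instance.
Context (R : realType) (K : choiceType).
Implicit Types (x y : ell1 R K) (s t : K -> bool).

Lemma ell1_nnsummable x : nnsummable (fun k => `|x k|).
Proof. by split=> //; have := valP x; rewrite inE. Qed.

Definition restrict x s k : R := if s k then x k else 0.

Lemma restrict_nnsummable x s : nnsummable (fun k => `|restrict x s k|).
Proof.
apply: nnsummable_le (ell1_nnsummable x) => k.
by rewrite normr_ge0/= /restrict; case: ifP => // _; rewrite normr0.
Qed.

(** The signed measure with density [x], evaluated at the set with indicator [s]; it turns [x] into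
    a function on the cube. *)
Definition ell1_mass s x : R := ell1_sum (restrict x s).

Lemma ell1_mass_linear s : linear_for *%R (ell1_mass s).
Proof.
move=> a x y; rewrite /ell1_mass -ell1_sum_linear; try exact: restrict_nnsummable.
congr ell1_sum; apply/funext => k; rewrite /restrict; case: ifP => // _.
by rewrite mulr0 addr0.
Qed.

HB.instance Definition _ s := GRing.isLinear.Build R (ell1 R K) R *%R
  (ell1_mass s) (ell1_mass_linear s).

Lemma ell1_mass_le s x : `|ell1_mass s x| <= `|x|.
Proof.
rewrite (le_trans (ell1_sum_le (restrict_nnsummable x s)))//.
apply: le_nnsum; last exact: ell1_nnsummable.
by move=> k; rewrite normr_ge0/= /restrict; case: ifP => // _; rewrite normr0.
Qed.

(** Two sets that agree on [F] have masses differing by at most the sum of [|x k|] outside [F]. *)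
Lemma ell1_mass_unif x (e : R) : 0 < e -> exists F : seq K,
  forall s t, (forall a, a \in F -> s a = t a) ->
    `|ell1_mass s x - ell1_mass t x| < e.
Proof.
move=> /(nnsum_tail (ell1_nnsummable x))[F FP]; exists F => s t st.
apply: le_lt_trans FP.
set h := fun k => if k \in F then 0 else `|x k|.
have nh : nnsummable h.
  apply: nnsummable_le (ell1_nnsummable x) => k.
  by rewrite /h; case: ifP; rewrite ?lexx ?normr_ge0.
pose d k := -1 * restrict x t k + restrict x s k.
have dh k : 0 <= `|d k| <= h k.
  rewrite normr_ge0/= /d /h /restrict; have [kF|kF] := boolP (k \in F).
    by rewrite st// mulN1r addNr normr0.
  case: (s k); case: (t k); rewrite ?mulN1r ?oppr0 ?addNr ?addr0 ?add0r ?normrN ?normr0//.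
have -> : ell1_mass s x - ell1_mass t x = ell1_sum d.
  rewrite ell1_sum_linear; try exact: restrict_nnsummable.
  by rewrite mulN1r addrC.
rewrite (le_trans (ell1_sum_le (nnsummable_le dh nh)))//.
exact: le_nnsum.
Qed.

(** The sets where [x] is nonnegative and where it is negative bound the positive and negative parts
    by [r] each, hence the factor 2. *)
Lemma ell1_mass_norming x r : (forall s, `|ell1_mass s x| <= r) -> `|x| <= 2 * r.
Proof.
move=> xr; pose u k := Num.max (x k) 0; pose v k := Num.max (- x k) 0.
have ux k : 0 <= u k <= `|x k|.
  by rewrite /u le_max lexx orbT ge_max ler_norm normr_ge0.
have vx k : 0 <= v k <= `|x k|.
  by rewrite /v le_max lexx orbT ge_max -normrN ler_norm normr_ge0.
have nu := nnsummable_le ux (ell1_nnsummable x).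
have nv := nnsummable_le vx (ell1_nnsummable x).
have n0 : nnsummable (fun _ : K => 0 : R) by split=> //; rewrite esum1// ltry.
have s0 : nnsum (fun _ : K => 0 : R) = 0 by rewrite /nnsum esum1.
have xE : `|x| = nnsum u + nnsum v.
  have [_ <-] := nnsummableD nu nv; rewrite [LHS]/(nnsum _); congr nnsum.
  apply/funext => k; rewrite /u /v; have [x0|x0] := leP 0 (x k).
    by rewrite ger0_norm// max_r ?oppr_le0// addr0.
  by rewrite ltr0_norm// max_l ?oppr_ge0 ?ltW// add0r.
have := xr (fun k => 0 <= x k); rewrite /ell1_mass.
rewrite (_ : restrict _ _ = (fun k => u k - 0)); last first.
  by apply/funext => k; rewrite /restrict /u subr0; case: leP.
rewrite ell1_sumB// s0 subr0 => /(le_trans (ler_norm _)) ur.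
have := xr (fun k => x k < 0); rewrite /ell1_mass.
rewrite (_ : restrict _ _ = (fun k => 0 - v k)); last first.
  apply/funext => k; rewrite /restrict /v sub0r; have [x0|x0] := ltP (x k) 0.
    by rewrite max_l ?opprK// oppr_ge0 ltW.
  by rewrite max_r ?oppr0// oppr_le0.
rewrite ell1_sumB// s0 sub0r normrN => /(le_trans (ler_norm _)) vr.
by rewrite xE; lra.
Qed.

Lemma Kunen_ell1 : Kunen_cardinal K ->
  forall N : ell1 R K -> R, equivalent_norm N -> Ba_measurable N.
Proof.
apply: (@Kunen_Ba_measurable R (ell1 R K) K ell1_mass 2) => //.
- exact: ell1_mass_unif.
- exact: ell1_mass_le.
- exact: ell1_mass_norming.
Qed.

Lemma esum_delta (a : K) :
  (\esum_(k in [set: K]) `|((k == a)%:R : R)%:E| = 1)%E.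
Proof.
rewrite (esumID [set a])//= setTI esum_set1//= eqxx normr1 setTI esum1 ?adde0//.
by move=> k /= /eqP/negPf ->; rewrite normr0.
Qed.

Lemma delta_abs_summable (a : K) : (fun k : K => (k == a)%:R : R) \in @abs_summable R K.
Proof. by rewrite inE/= /summable/= esum_delta ltry. Qed.

Definition ell1_delta (a : K) : ell1 R K := Ell1 (delta_abs_summable a).

Definition ell1_coordinate (c : K) x : R := x c.

Lemma ell1_coordinate_linear c : linear_for *%R (ell1_coordinate c).
Proof. by []. Qed.

HB.instance Definition _ c := GRing.isLinear.Build R (ell1 R K) R *%R
  (ell1_coordinate c) (ell1_coordinate_linear c).

Lemma ell1_coordinate_le c x : `|ell1_coordinate c x| <= `|x|.
Proof.
rewrite -lee_fin -[leRHS]/((ell1_norm x)%:E) ell1_normE.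
by apply: esum_ge; exists [set c]; [split|rewrite fsbig_set1].
Qed.

Lemma ell1_Kunen :
  (forall N : ell1 R K -> R, equivalent_norm N -> Ba_measurable N) ->
  Kunen_cardinal K.
Proof.
apply: (@Kunen_of_measurable_norms R (ell1 R K) K ell1_delta ell1_coordinate).
- by [].
- move=> c x; have := ell1_coordinate_le c x; have := normr_ge0 x; lra.
- by move=> a; rewrite -lee_fin -[leLHS]/((ell1_norm _)%:E) ell1_normE esum_delta.
Qed.

End ell1_instance.

Theorem corollary4p5 (R : realType) (K : choiceType) :
  [<-> Kunen_cardinal K ;
       forall N : ell1 R K -> R, equivalent_norm N -> Ba_measurable N ;
       forall N : C_cube R K -> R, equivalent_norm N -> Ba_measurable N].
Proof.
split; first exact: Kunen_ell1.
split; last exact: C_cube_Kunen.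
(* The passage between the two spaces goes through Kunen's property. *)
by move=> /ell1_Kunen; exact: Kunen_C_cube.
Qed.
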